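(* There exists a deterministic sequence of integers $N_k\to\infty$ (in fact one may take $N_k=2^{n_k}$ with $n_k\to\infty$) such that the sequence of random variables $\{Y_{N_k}\}_{k\ge 1}$, where $Y_N:=X_N^*-E X_N^*$, is tight.
   Context: For an integer $N\ge 1$ let $V_N=(\{0,1,\dots,N\})^2\subset\mathbb Z^2$, $V_N^o=(\{1,\dots,N-1\})^2$, and $\partial V_N=V_N\setminus V_N^o$. Let $\{w_m\}_{m\ge0}$ be simple random walk on $\mathbb Z^2$ started in $V_N$, killed at $\tau=\min\{m: w_m\in\partial V_N\}$, and define the Green function $G_N(x,y)=E^x\big(\sum_{m=0}^{\tau}\mathbf 1_{\{w_m=y\}}\big)$ for $x,y\in V_N$ (with $E^x$ expectation for the walk started at $x$; in particular $G_N(x,y)=0$ if $x$ or $y\in\partial V_N$). The discrete Gaussian free field (GFF) on $V_N$ with Dirichlet boundary conditions is the centered Gaussian field $\{X^N_z\}_{z\in V_N}$ with covariance $E[X^N_xX^N_y]=G_N(x,y)$. Write $X_N^*=\max_{z\in V_N}X^N_z$. *)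

(* Defs.v *)
From HB Require Import structures.
From mathcomp Require Import all_boot all_order all_algebra.
From mathcomp Require Import all_classical all_reals all_analysis.
Set Implicit Arguments. Unset Strict Implicit. Unset Printing Implicit Defensive.
Import Order.TTheory GRing.Theory Num.Theory.
Local Open Scope classical_set_scope.
Local Open Scope ring_scope.

(* Points of Z^2 inside V_N are encoded with nat coordinates (all points of
   V_N = {0..N}^2 have nonnegative coordinates). *)

Definition interior (N : nat) (x : nat * nat) : bool :=
  [&& 0 < x.1, x.1 < N, 0 < x.2 & x.2 < N]%N.

(* the four nearest neighbours in Z^2 (exact for interior points) *)
Definition nbrs (x : nat * nat) : seq (nat * nat) :=
  [:: (x.1.+1, x.2); (x.1.-1, x.2); (x.1, x.2.+1); (x.1, x.2.-1)].

(* walkcount N m x y = number of nearest-neighbour paths w_0 = x, ..., w_m = y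
   of length m with every w_i in V_N^o.  Hence 4^{-m} * walkcount N m x y
   = P^x(w_m = y, m < tau) for the simple random walk killed on hitting
   the boundary of V_N. *)
Fixpoint walkcount (N m : nat) (x y : nat * nat) : nat :=
  if interior N x then
    match m with
    | 0 => nat_of_bool (x == y)
    | m'.+1 => sumn [seq walkcount N m' z y | z <- nbrs x]
    end
  else 0.

(* Green function G_N(x,y) = E^x sum_{m} 1{w_m = y, m before tau},
   and G_N(x,y) = 0 when x or y lies on the boundary. *)
Definition green {R : realType} (N : nat) (x y : nat * nat) : R :=
  if interior N x && interior N y then
    fine (\sum_(m <oo) (((walkcount N m x y)%:R / 4%:R ^+ m : R)%:E))%E
  else 0.

Definition VN (N : nat) : finType := ('I_N.+1 * 'I_N.+1)%type.

Definition pt (N : nat) (v : VN N) : nat * nat := (nat_of_ord v.1, nat_of_ord v.2).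

(* A family X of real random variables indexed by a finite type I is a
   centered Gaussian vector with covariance C: every linear combination
   sum_i a_i X_i is a centered normal variable with variance a^T C a
   (a degenerate normal, i.e. a.s. zero, when the variance is 0). *)
Definition centered_gaussian {R : realType} {d : measure_display}
  {T : measurableType d} (P : probability T R) (I : finType)
  (C : I -> I -> R) (X : I -> T -> R) : Prop :=
  (forall i, measurable_fun setT (X i)) /\
  forall a : I -> R,
    let S := fun w => \sum_(i : I) a i * X i w in
    let q := \sum_(i : I) \sum_(j : I) a i * a j * C i j in
    if q == 0 then P [set w | S w != 0] = 0%E
    else forall A : set R, measurable A ->
      P (S @^-1` A) = normal_prob 0 (Num.sqrt q) A.

Definition is_DGFF {R : realType} {d : measure_display} {T : measurableType d}
  (P : probability T R) (N : nat) (X : VN N -> T -> R) : Prop :=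
  centered_gaussian P (fun u v => green N (pt u) (pt v)) X.

Definition fieldmax {R : realType} {T : Type} (N : nat) (X : VN N -> T -> R)
  (w : T) : R :=
  \big[Num.max/X (ord0, ord0) w]_(v : VN N) X v w.

(* Main.v *)
(* Let M, M' be the maxima of two independent copies of the field on V_N, with
   N = 2^n, and let a_n be the mean of M. The two copies, placed in opposite
   corners of V_2N, have a covariance dominated (as a quadratic form) by the one
   of the field on V_2N, because enlarging the domain increases the Green form.
   By convexity, adding an independent centered Gaussian vector can only increase
   the mean of the maximum, so that
     a_(n+1) >= E max(M, M') = a_n + E|M - M'| / 2 >= a_n + E|M - a_n| / 2.
   Since G_N(x,x) = O(log N), a_n grows at most linearly, hence a_(n+1) - a_n is
   bounded along a subsequence; Markov's inequality concludes. *)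

Require Import Defs.
From HB Require Import structures.
From mathcomp Require Import all_boot all_order all_algebra.
From mathcomp Require Import all_classical all_reals all_analysis.
From mathcomp Require Import measurable_realfun.
From mathcomp Require Import ring lra zify.
Set Implicit Arguments. Unset Strict Implicit. Unset Printing Implicit Defensive.
Import Order.TTheory GRing.Theory Num.Theory.
Import numFieldNormedType.Exports.
Local Open Scope classical_set_scope.
Local Open Scope ring_scope.

(** * Dirichlet form and cone inequality *)

(** Enlarging the domain increases the Green form because [green N] is, up to a factor 4, the
    reproducing kernel of the Dirichlet form on functions supported in the interior: its quadratic
    form is a quarter of the energy of a potential, and the potential of a subdomain is an
    orthogonal projection of that of the domain. The same property turns an inequality f(x)^2 <= c *
    energy(f) into a bound on G_N(x,x). The obstacle is probabilistic. A Gaussian vector is known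
    only through the one-dimensional laws of its linear combinations, on an arbitrary probability
    space. The mean of the maximum must therefore be shown to depend on the covariance alone, which
    is a Cramer-Wold argument made with cosines; after that, each comparison may be carried out on a
    space built for it, a product with standard normal laws. The Gaussian vector added in the
    convexity step is split by a Gram decomposition into terms v xi, each with a single normal
    variable xi. *)

Lemma sum_sqr_le {R : realDomainType} (I : Type) (r : seq I) (d c e : I -> R) :
  (forall i, 0 <= c i) -> (forall i, 0 <= e i) ->
  (forall i, d i ^+ 2 <= c i * e i) ->
  (\sum_(i <- r) d i) ^+ 2 <= (\sum_(i <- r) c i) * \sum_(i <- r) e i.
Proof.
move=> c0 e0 dce; elim: r => [|i r]; first by rewrite !big_nil expr0n mul0r.
rewrite !big_cons.
have : 0 <= \sum_(j <- r) c j by apply: sumr_ge0.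
have : 0 <= \sum_(j <- r) e j by apply: sumr_ge0.
move: (\sum_(j <- r) d j) (\sum_(j <- r) c j) (\sum_(j <- r) e j) => D C E E0 C0 IH.
have [[ci ei] di] := (c0 i, e0 i, dce i).
(* AM-GM without square roots: (2 d D)^2 <= 4 (c e)(C E) <= (c E + C e)^2. *)
have cross : 2 * (d i * D) <= c i * E + C * e i.
  have pos : 0 <= c i * E + C * e i by rewrite addr_ge0 ?mulr_ge0.
  rewrite (le_trans (ler_norm _))// -(ler_pXn2r (n := 2)) ?nnegrE//.
  rewrite real_normK ?num_real//.
  have h1 : (d i ^+ 2) * (D ^+ 2) <= (c i * e i) * (C * E).
    by apply: ler_pM => //; exact: sqr_ge0.
  have h2 := sqr_ge0 (c i * E - C * e i).
  apply: (@le_trans _ _ (4 * (c i * e i * (C * E)))).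
    by rewrite (_ : _ ^+ 2 = 4 * (d i ^+ 2 * D ^+ 2)) ?ler_pM2l//; ring.
  by rewrite -subr_ge0 (_ : _ - _ = (c i * E - C * e i) ^+ 2)//; ring.
rewrite -subr_ge0 (_ : _ - _ = (c i * e i - d i ^+ 2) + (C * E - D ^+ 2) +
  (c i * E + C * e i - 2 * (d i * D))); last by ring.
by apply: addr_ge0; [apply: addr_ge0|]; rewrite subr_ge0.
Qed.

Lemma sum_shift_le {R : realDomainType} (F : nat -> R) (K a m : nat) :
  (forall i, 0 <= F i) -> (forall i, (K <= i)%N -> F i = 0) ->
  \sum_(k < m) F (a + k)%N <= \sum_(i < K) F i.
Proof.
move=> F0 FK.
rewrite -(big_mkord xpredT (fun k => F (a + k)%N)) -(big_mkord xpredT F) /=.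
have -> : \sum_(0 <= i < K) F i = \sum_(0 <= i < a + m + K) F i.
  rewrite (big_cat_nat (n := K) (p := a + m + K)) ?leq_addl//=.
  have -> : \sum_(K <= i < a + m + K) F i = 0; last by rewrite addr0.
  by rewrite big_nat_cond big1// => i /andP[/andP[Ki _] _]; exact: FK.
rewrite (big_cat_nat (n := a) (p := a + m + K)) //=; last first.
  by rewrite -addnA leq_addr.
rewrite (big_cat_nat (m := a) (n := (a + m)%N) (p := a + m + K)) ?leq_addr//=.
have -> : \sum_(0 <= k < m) F (a + k)%N = \sum_(a <= i < a + m) F i.
  rewrite -{2}(add0n a) big_addn addKn.
  by apply: eq_bigr => i _; rewrite addnC.
by rewrite addrCA lerDl addr_ge0 ?sumr_ge0.
Qed.

Section dirichlet_form.
Context {R : realFieldType}.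
Implicit Types u v : nat * nat -> R.

(* [4 (I - P)], with [P] the transition operator of the simple random walk *)
Definition lap u (x : nat * nat) : R := 4 * u x - \sum_(z <- nbrs x) u z.

Definition vanish_off (K : nat) u := forall x, ~~ Defs.interior K x -> u x = 0.

Definition dirichlet (K : nat) u v : R :=
  \sum_(i < K.+1) \sum_(j < K.+1)
    ((u (i.+1, j : nat) - u (i : nat, j : nat)) * (v (i.+1, j : nat) - v (i : nat, j : nat))
   + (u (i : nat, j.+1) - u (i : nat, j : nat)) * (v (i : nat, j.+1) - v (i : nat, j : nat))).

Lemma dirichletC K u v : dirichlet K u v = dirichlet K v u.
Proof. by apply: eq_bigr => i _; apply: eq_bigr => j _; ring. Qed.

Lemma dirichlet_ge0 K u : 0 <= dirichlet K u u.
Proof.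
apply: sumr_ge0 => i _; apply: sumr_ge0 => j _.
by rewrite -!expr2 addr_ge0 ?sqr_ge0.
Qed.

Lemma dirichletBl K u1 u2 v :
  dirichlet K (fun x => u1 x - u2 x) v = dirichlet K u1 v - dirichlet K u2 v.
Proof.
rewrite -sumrB; apply: eq_bigr => i _; rewrite -sumrB; apply: eq_bigr => j _.
by ring.
Qed.

(* no boundary term at [0], since [0.-1 = 0] *)
Lemma sum_by_parts (n : nat) (f g : nat -> R) :
  \sum_(i < n) (f i.+1 - f i) * (g i.+1 - g i) =
  \sum_(i < n) g i * (2 * f i - f i.+1 - f i.-1) + g n * (f n - f n.-1).
Proof.
elim: n => [|n IH]; first by rewrite !big_ord0 subrr mulr0 addr0.
by rewrite !big_ord_recr/= IH; ring.
Qed.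

Lemma vanish_ge K u : vanish_off K u ->
  (forall i j, (K <= i)%N -> u (i, j) = 0) *
  (forall i j, (K <= j)%N -> u (i, j) = 0).
Proof.
by move=> uK; split=> i j Ki; apply: uK; rewrite /Defs.interior/=;
  apply/negP => /and4P[*]; lia.
Qed.

(** Green's identity. The boundary terms carry a factor [v], hence vanish; so do the sites with a
    zero coordinate, where the truncated predecessor makes [lap] differ from the true Laplacian. *)
Lemma dirichletE K u v : vanish_off K v ->
  dirichlet K u v =
  \sum_(i < K.+1) \sum_(j < K.+1) v (i : nat, j : nat) * lap u (i : nat, j : nat).
Proof.
move=> vK; rewrite /dirichlet.
transitivity (\sum_(i < K.+1) \sum_(j < K.+1)
    v (i : nat, j : nat) * (2 * u (i : nat, j : nat) - u (i.+1, j : nat) - u (i.-1, j : nat))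
  + \sum_(i < K.+1) \sum_(j < K.+1)
    v (i : nat, j : nat) * (2 * u (i : nat, j : nat) - u (i : nat, j.+1) - u (i : nat, j.-1))).
  under eq_bigr do rewrite big_split/=.
  rewrite big_split/=; congr (_ + _).
    rewrite exchange_big/= [RHS]exchange_big/=; apply: eq_bigr => j _.
    rewrite (sum_by_parts _ (fun i => u (i, j : nat)) (fun i => v (i, j : nat))).
    by rewrite (vanish_ge vK).1 ?mul0r ?addr0.
  apply: eq_bigr => i _.
  rewrite (sum_by_parts _ (fun j => u (i : nat, j)) (fun j => v (i : nat, j))).
  by rewrite (vanish_ge vK).2 ?mul0r ?addr0.
rewrite -big_split/=; apply: eq_bigr => i _; rewrite -big_split/=.
by apply: eq_bigr => j _; rewrite /lap /nbrs !big_cons big_nil/=; ring.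
Qed.

(* [A k] averages [u] over the column [(x1 + k, x2 + j)], [j <= k], of a cone
   with apex [x]: the difference of two consecutive averages is a combination
   with coefficients [O(1/k)] of [O(k)] edge gradients, and edges of different
   columns are disjoint. *)
Lemma cone_ineq K u x : vanish_off K u ->
  u x ^+ 2 <= 2 * (\sum_(k < K) k.+1%:R^-1) * dirichlet K u u.
Proof.
move=> uK; case: x => x1 x2.
pose U k j := u (x1 + k, x2 + j)%N.
pose A k := k.+1%:R^-1 * \sum_(j < k.+1) U k j.
pose E k := \sum_(j < k.+1) ((U k j - U k.+1 j) ^+ 2 + (U k.+1 j - U k.+1 j.+1) ^+ 2).
have E0 k : 0 <= E k by apply: sumr_ge0 => j _; rewrite addr_ge0 ?sqr_ge0.
(* Comparing averages over k+1 and k+2 points leaves the last point against the mean of the others;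
   summation by parts writes this as edge differences with weights (j+1)/(k+2). *)
have abel n (w : nat -> R) : \sum_(j < n) j.+1%:R * (w j - w j.+1) =
    \sum_(j < n) w j - n%:R * w n.
  elim: n => [|n IH]; first by rewrite !big_ord0 mul0r subrr.
  by rewrite !big_ord_recr/= IH -natr1; ring.
have dA k : (A k - A k.+1) ^+ 2 <= 2 * k.+1%:R^-1 * E k.
  have -> : A k - A k.+1 = \sum_(j < k.+1) k.+1%:R^-1 *
      ((U k j - U k.+1 j) + j.+1%:R / k.+2%:R * (U k.+1 j - U k.+1 j.+1)).
    rewrite -mulr_sumr big_split/= sumrB.
    have -> : \sum_(j < k.+1) j.+1%:R / k.+2%:R * (U k.+1 j - U k.+1 j.+1) =
        (\sum_(j < k.+1) U k.+1 j - k.+1%:R * U k.+1 k.+1) / k.+2%:R.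
      by rewrite -abel mulr_suml; apply: eq_bigr => j _; rewrite mulrAC.
    rewrite /A [\sum_(j < k.+2) _]big_ord_recr/=.
    move: (\sum_(i < k.+1) U k.+1 i) (\sum_(i < k.+1) U k i) => s t.
    have k1 : k.+1%:R != 0 :> R by rewrite pnatr_eq0.
    have k2 : 1 + k.+1%:R != 0 :> R by rewrite nat1r pnatr_eq0.
    rewrite -[k.+2%:R]nat1r; move: (k.+1%:R : R) k1 k2 => c c0 c1.
    by field; rewrite c0 c1.
  apply: le_trans (sum_sqr_le (c := fun=> 2 * k.+1%:R^-1 ^+ 2)
     (e := fun j : 'I_k.+1 =>
        (U k j - U k.+1 j) ^+ 2 + (U k.+1 j - U k.+1 j.+1) ^+ 2) _ _ _ _) _.
  - by move=> _; rewrite mulr_ge0 ?sqr_ge0.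
  - by move=> j; rewrite addr_ge0 ?sqr_ge0.
  (* The factor 2 comes from (a + l b)^2 <= 2 (a^2 + b^2) for 0 <= l <= 1. *)
  - move=> j; rewrite exprMn [leRHS]mulrAC [leRHS]mulrC ler_wpM2l ?sqr_ge0//.
    set a := U k j - _; set b := U k.+1 j - _; set l := _ / _.
    have l0 : 0 <= l by rewrite divr_ge0.
    have l1 : l <= 1.
      by rewrite ler_pdivrMr// mul1r ler_nat ltnS ltnW.
    have : (l * b) ^+ 2 <= b ^+ 2.
      by rewrite exprMn ler_piMl ?sqr_ge0// expr_le1.
    have := sqr_ge0 (a - l * b); nra.
  rewrite sumr_const card_ord -/(E k) -[_ *+ k.+1]mulr_natr.
  have : k.+1%:R != 0 :> R by rewrite pnatr_eq0.
  move: (k.+1%:R : R) => c c0; rewrite le_eqVlt; apply/orP; left; apply/eqP.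
  by field.
have A0 : u (x1, x2) = A 0%N.
  by rewrite /A big_ord_recl big_ord0 invr1 mul1r addr0 /U !addn0.
(* The column of index [K] lies outside the interior, so the averages telescope from [u x] down to
   zero. *)
have AK : A K = 0.
  rewrite /A big1 ?mulr0// => j _.
  by rewrite /U (vanish_ge uK).1 ?leq_addl.
have -> : u (x1, x2) = \sum_(k < K) (A k - A k.+1).
  have -> : \sum_(k < K) (A k - A k.+1) = - \sum_(k < K) (A k.+1 - A k).
    by rewrite -sumrN; apply: eq_bigr => k _; rewrite opprB.
  rewrite -(big_mkord xpredT (fun k => A k.+1 - A k)) telescope_sumr//.
  by rewrite AK sub0r opprK.
apply: le_trans (sum_sqr_le (c := fun k : 'I_K => 2 * k.+1%:R^-1)
   (e := fun k : 'I_K => E k) _ _ _ _) _ => //.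
rewrite -mulr_sumr ler_wpM2l//.
  by rewrite mulr_ge0// sumr_ge0.
pose D1 i j := (u (i.+1, j) - u (i, j)) ^+ 2.
pose D2 i j := (u (i, j.+1) - u (i, j)) ^+ 2.
have D1K i j : ((K <= i) || (K <= j))%N -> D1 i j = 0.
  move=> /orP[] Kij; rewrite /D1.
    by rewrite !(vanish_ge uK).1 ?subr0 ?expr0n// leqW.
  by rewrite !(vanish_ge uK).2 ?subr0 ?expr0n.
have D2K i j : ((K <= i) || (K <= j))%N -> D2 i j = 0.
  move=> /orP[] Kij; rewrite /D2.
    by rewrite !(vanish_ge uK).1 ?subr0 ?expr0n.
  by rewrite !(vanish_ge uK).2 ?subr0 ?expr0n// leqW.
have cone_sum D a : (forall i j, 0 <= D i j :> R) ->
    (forall i j, ((K <= i) || (K <= j))%N -> D i j = 0) ->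
    \sum_(k < K) \sum_(j < k.+1) D (a + k)%N (x2 + j)%N <=
    \sum_(i < K.+1) \sum_(j < K.+1) D i j.
  move=> D0 DK.
  apply: (@le_trans _ _ (\sum_(k < K) \sum_(j < K.+1) D (a + k)%N j)).
    apply: ler_sum => k _.
    apply: (@sum_shift_le _ (D (a + k)%N) K.+1 x2) => // j Kj.
    by rewrite DK ?(ltnW Kj) ?orbT.
  apply: (@sum_shift_le _ (fun i => \sum_(j < K.+1) D i j) K.+1 a) => i => [|Ki].
    exact: sumr_ge0.
  by rewrite big1// => j _; rewrite DK ?(ltnW Ki).
rewrite /dirichlet /E.
under eq_bigr do rewrite big_split/=.
rewrite big_split/=.
under [leRHS]eq_bigr do rewrite big_split/=.
rewrite [leRHS]big_split/=; apply: lerD.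
  apply: le_trans (cone_sum D1 x1 (fun _ _ => sqr_ge0 _) D1K).
  rewrite le_eqVlt; apply/orP; left; apply/eqP.
  apply: eq_bigr => k _; apply: eq_bigr => j _.
  by rewrite /D1 /U addnS -sqrrN opprB.
(* The second-coordinate edges of [E k] lie in the column of index k+1, hence the base [x1.+1]. *)
apply: le_trans (cone_sum D2 x1.+1 (fun _ _ => sqr_ge0 _) D2K).
rewrite le_eqVlt; apply/orP; left; apply/eqP.
apply: eq_bigr => k _; apply: eq_bigr => j _.
by rewrite /D2 /U !addnS addSn -sqrrN opprB.
Qed.

End dirichlet_form.

(** * Green function *)

Section green_function.
Context {R : realType}.
Implicit Types (N M : nat) (x y : nat * nat).

(** [green] takes [fine] of a series, which would give 0 if the series diverged; the truncations are
    bounded uniformly in [M] before any passage to the limit. *)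
Definition pgreen N M x y : R := \sum_(m < M) (walkcount N m x y)%:R / 4 ^+ m.

Lemma walkcount_off N m x y : ~~ Defs.interior N x -> walkcount N m x y = 0%N.
Proof. by case: m => [|m] /= /negbTE ->. Qed.

Lemma walkcount0 N x y : Defs.interior N x -> walkcount N 0 x y = (x == y).
Proof. by move=> Nx; rewrite /= Nx. Qed.

Lemma pgreen_vanish N M y : vanish_off N (pgreen N M ^~ y).
Proof. by move=> x Nx; apply: big1 => m _; rewrite walkcount_off// mul0r. Qed.

Lemma pgreen_ge0 N M x y : 0 <= pgreen N M x y.
Proof. by apply: sumr_ge0 => m _; rewrite divr_ge0// exprn_ge0. Qed.

Lemma pgreen_nd N x y : nondecreasing_seq (fun M => pgreen N M x y).
Proof.
apply/nondecreasing_seqP => M; rewrite /pgreen big_ord_recr/= lerDl.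
by rewrite divr_ge0// exprn_ge0.
Qed.

Lemma pgreenS N M x y : Defs.interior N x ->
  pgreen N M.+1 x y = (x == y)%:R + 4^-1 * \sum_(z <- nbrs x) pgreen N M z y.
Proof.
move=> Nx; rewrite /pgreen big_ord_recl walkcount0// expr0 divr1; congr (_ + _).
rewrite exchange_big/= mulr_sumr; apply: eq_bigr => m _.
rewrite /= Nx !add0n /bump leq0n add1n exprS invfM mulrA [_ * 4^-1]mulrC -mulrA; congr (_ * _).
by rewrite /nbrs !big_cons big_nil addn0 !natrD; ring.
Qed.

Lemma sum_grid_delta K (f : nat * nat -> R) y : Defs.interior K y ->
  \sum_(i < K.+1) \sum_(j < K.+1)
    f (i : nat, j : nat) * ((i : nat, j : nat) == y)%:R = f y.
Proof.
case: y => y1 y2 /and4P[/= _ y1K _ y2K].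
rewrite (bigD1 (Ordinal (ltnW y1K : y1 < K.+1)%N))//=.
rewrite (bigD1 (Ordinal (ltnW y2K : y2 < K.+1)%N))//= eqxx mulr1.
rewrite !big1 ?addr0// => [i iy|j jy].
  rewrite big1// => j _; rewrite xpair_eqE.
  by rewrite (_ : (i == y1 :> nat) = false) ?mulr0//; apply: negbTE.
rewrite xpair_eqE eqxx/=.
by rewrite (_ : (j == y2 :> nat) = false) ?mulr0//; apply: negbTE.
Qed.

(** For g = [pgreen N M ^~ y], the one-step recursion and monotonicity in [M] give lap g <= 4
    delta_y on the interior, so the energy of g is at most 4 g(y) and [cone_ineq] applies. At x = y
    a factor g(y) cancels, which leaves a bound uniform in [M]. *)
Lemma pgreen_sqr_le N M x y : Defs.interior N y ->
  pgreen N M x y ^+ 2 <= 8 * (\sum_(k < N) k.+1%:R^-1) * pgreen N M y y.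
Proof.
move=> Ny; apply: le_trans (cone_ineq x (@pgreen_vanish N M y)) _.
rewrite (_ : 8 = 2 * 4)//; last by ring.
rewrite -!mulrA ler_pM2l// [4 * _]mulrCA ler_wpM2l//; first exact: sumr_ge0.
rewrite (dirichletE _ (@pgreen_vanish N M y)).
rewrite -(sum_grid_delta (fun x => pgreen N M x y) Ny) mulr_sumr.
apply: ler_sum => i _; rewrite mulr_sumr; apply: ler_sum => j _.
set z := (_, _); have [Nz|Nz] := boolP (Defs.interior N z); last first.
  by rewrite pgreen_vanish// !mul0r mulr0.
rewrite mulrCA ler_wpM2l ?pgreen_ge0// /lap lerBlDr.
have := pgreen_nd N z y (leqnSn M); rewrite pgreenS// => h.
by rewrite (le_trans (ler_wpM2l _ h))// mulrDr mulrA mulfV ?mul1r.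
Qed.

Lemma pgreen_diag_le N M y : Defs.interior N y ->
  pgreen N M y y <= 8 * \sum_(k < N) k.+1%:R^-1.
Proof.
move=> Ny; have := pgreen_sqr_le M y Ny; rewrite expr2.
have [-> _|p0] := eqVneq (pgreen N M y y) 0.
  by rewrite mulr_ge0// sumr_ge0.
by rewrite ler_pM2r// lt_def p0 pgreen_ge0.
Qed.

Lemma pgreen_le N M x y : Defs.interior N y ->
  pgreen N M x y <= 8 * \sum_(k < N) k.+1%:R^-1.
Proof.
move=> Ny; have H0 : 0 <= 8 * \sum_(k < N) k.+1%:R^-1 :> R.
  by rewrite mulr_ge0// sumr_ge0.
rewrite -(ler_pXn2r (n := 2)) ?nnegrE ?pgreen_ge0//.
apply: le_trans (pgreen_sqr_le M x Ny) _; rewrite expr2 ler_wpM2l//.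
exact: pgreen_diag_le.
Qed.

Lemma cvg_pgreen N x y : Defs.interior N y ->
  pgreen N M x y @[M --> \oo] --> green N x y.
Proof.
move=> Ny; rewrite /green Ny andbT; case: ifPn => Nx; last first.
  by under eq_fun do rewrite pgreen_vanish//; exact: cvg_cst.
have cv : cvgn (fun M => pgreen N M x y).
  apply: (nondecreasing_is_cvgn (pgreen_nd N x y)).
  exists (8 * \sum_(k < N) k.+1%:R^-1) => _ [M _ <-]; exact: pgreen_le.
suff -> : (\sum_(m <oo) ((walkcount N m x y)%:R / 4%:R ^+ m : R)%:E)%E =
   (limn (fun M => pgreen N M x y))%:E by [].
rewrite -EFin_lim//; congr (limn _); apply/funext => M /=.
by rewrite sumEFin /pgreen big_mkord.
Qed.

Lemma green_vanish N y : vanish_off N (green N ^~ y : nat * nat -> R).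
Proof. by move=> x Nx; rewrite /green (negbTE Nx). Qed.

Lemma green_off N x y : ~~ Defs.interior N y -> green N x y = 0 :> R.
Proof. by move=> Ny; rewrite /green (negbTE Ny) andbF. Qed.

Lemma green_diag_le N y : green N y y <= 8 * \sum_(k < N) k.+1%:R^-1 :> R.
Proof.
have [Ny|Ny] := boolP (Defs.interior N y); last first.
  by rewrite green_off// mulr_ge0// sumr_ge0.
have cv := cvg_pgreen (x := y) Ny.
rewrite -(cvg_lim _ cv)//; apply: limr_le; first by apply/cvg_ex; eexists; exact: cv.
by apply: nearW => M; exact: pgreen_diag_le.
Qed.

(** The recursion [pgreenS] passes to the limit; the factor 4 is the normalisation of [lap]. *)
Lemma lap_green N x y : Defs.interior N x ->
  lap (green N ^~ y : nat * nat -> R) x = 4 * ((x == y) && Defs.interior N y)%:R.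
Proof.
move=> Nx; have [Ny|Ny] := boolP (Defs.interior N y); last first.
  rewrite andbF mulr0 /lap green_off// mulr0 big1 ?subr0// => z _.
  exact: green_off.
rewrite andbT /lap.
have cvS : pgreen N M.+1 x y @[M --> \oo] -->
    (x == y)%:R + 4^-1 * \sum_(z <- nbrs x) green N z y.
  under eq_fun do rewrite pgreenS//.
  apply: cvgD; first exact: cvg_cst.
  apply: cvgMr; rewrite /nbrs.
  under eq_fun do rewrite !big_cons big_nil.
  rewrite !big_cons big_nil.
  by do !apply: cvgD; try exact: cvg_pgreen; exact: cvg_cst.
have cvG : pgreen N M.+1 x y @[M --> \oo] --> green N x y.
  by have := cvg_pgreen (x := x) Ny; rewrite -cvg_shiftS.
rewrite -(cvg_lim _ cvG)// (cvg_lim _ cvS)//.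
by rewrite mulrDr mulrA mulfV ?mul1r ?addrK ?pnatr_eq0.
Qed.

(** Each dyadic block, from 2^n to 2^(n+1) - 1, contributes at most 1. *)
Lemma harmonic_pow2_le n : \sum_(k < 2 ^ n) k.+1%:R^-1 <= n.+1%:R :> R.
Proof.
elim: n => [|n IH]; first by rewrite big_ord_recl big_ord0 invr1 addr0.
rewrite expnS mul2n -addnn -(big_mkord xpredT (fun k => k.+1%:R^-1)).
rewrite (big_cat_nat (n := 2 ^ n)) ?leq_addr//= big_mkord -[n.+2%:R]natr1 lerD//.
apply: (@le_trans _ _ (\sum_(2 ^ n <= k < 2 ^ n + 2 ^ n) (2 ^ n)%:R^-1)).
  rewrite big_nat_cond [leRHS]big_nat_cond; apply: ler_sum => k /andP[/andP[nk _] _].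
  by rewrite lef_pV2 ?posrE ?ltr0n ?expn_gt0// ler_nat leqW.
by rewrite sumr_const_nat addnK -(mulr_natr (_^-1)) mulVf// pnatr_eq0 expn_eq0.
Qed.

End green_function.

(** * Comparison of Green forms *)

Section green_comparison.
Context {R : realType}.
Implicit Types (N K : nat) (x y : nat * nat).

Lemma lap_sum (I : finType) (c : I -> R) (f : I -> nat * nat -> R) x :
  lap (fun z => \sum_i c i * f i z) x = \sum_i c i * lap (f i) x.
Proof.
rewrite /lap /nbrs !big_cons !big_nil/= addr0 mulr_sumr -!big_split/= -sumrB.
by apply: eq_bigr => i _; rewrite !big_cons big_nil; ring.
Qed.

Lemma lapD (f g : nat * nat -> R) x :
  lap (fun z => f z + g z) x = lap f x + lap g x.
Proof. by rewrite /lap /nbrs !big_cons !big_nil; ring. Qed.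

Definition potential (I : finType) K (p : I -> nat * nat) (c : I -> R) x : R :=
  \sum_i c i * green K x (p i).

Lemma potential_vanish (I : finType) K (p : I -> nat * nat) c :
  vanish_off K (potential K p c).
Proof. by move=> x Kx; apply: big1 => i _; rewrite green_vanish// mulr0. Qed.

Lemma lap_potential (I : finType) K (p : I -> nat * nat) c x :
  Defs.interior K x ->
  lap (potential K p c) x =
  \sum_i c i * (4 * ((x == p i) && Defs.interior K (p i))%:R).
Proof.
by move=> Kx; rewrite lap_sum; apply: eq_bigr => i _; rewrite lap_green.
Qed.

(** By Green's identity only the values of [f] at the charges survive. Thus [green K] is the
    reproducing kernel of a quarter of the Dirichlet form, whence its symmetry and positivity. *)
Lemma dirichlet_potential (I : finType) K (p : I -> nat * nat) c f :
  vanish_off K f ->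
  dirichlet K (potential K p c) f = 4 * \sum_i c i * f (p i).
Proof.
move=> fK; rewrite dirichletE//.
transitivity (\sum_s \sum_(i < K.+1) \sum_(j < K.+1)
   4 * (c s * (f (i : nat, j : nat) *
     (((i : nat, j : nat) == p s) && Defs.interior K (p s))%:R))).
  rewrite [RHS]exchange_big/=; apply: eq_bigr => i _.
  rewrite [RHS]exchange_big/=; apply: eq_bigr => j _.
  have [Kx|Kx] := boolP (Defs.interior K (i : nat, j : nat)).
    by rewrite lap_potential// mulr_sumr; apply: eq_bigr => s _; ring.
  by rewrite fK// mul0r big1// => s _; rewrite mul0r !mulr0.
rewrite mulr_sumr; apply: eq_bigr => s _.
under eq_bigr do rewrite -!mulr_sumr.
rewrite -!mulr_sumr; congr (_ * (_ * _)).
have [Ks|Ks] := boolP (Defs.interior K (p s)).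
  under eq_bigr do under eq_bigr do rewrite andbT.
  exact: sum_grid_delta.
rewrite fK// big1// => i _; rewrite big1// => j _.
by rewrite andbF mulr0.
Qed.

Lemma green_sym N x y : green N x y = green N y x :> R.
Proof.
have h z t : dirichlet N (green N ^~ z) (green N ^~ t : nat * nat -> R) = 4 * green N z t.
  have -> : (green N ^~ z : nat * nat -> R) =
      potential N (fun=> z) (fun _ : 'I_1 => 1).
    by apply/funext => s; rewrite /potential big_ord1 mul1r.
  rewrite dirichlet_potential ?big_ord1 ?mul1r//; exact: green_vanish.
by apply: (@mulfI _ 4) => //; rewrite -!h dirichletC.
Qed.

Lemma green_psd (I : finType) N (p : I -> nat * nat) (c : I -> R) :
  0 <= \sum_i \sum_j c i * c j * green N (p i) (p j).
Proof.
have := dirichlet_ge0 N (potential N p c).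
rewrite dirichlet_potential; last exact: potential_vanish.
rewrite pmulr_rge0// => h; under eq_bigr do under eq_bigr do rewrite -mulrA.
by under eq_bigr do rewrite -mulr_sumr.
Qed.

Definition block (I J : Type) (C : I -> I -> R) (D : J -> J -> R) (s t : I + J) : R :=
  match s, t with
  | inl i, inl i' => C i i'
  | inr j, inr j' => D j j'
  | _, _ => 0
  end.

(** With a shift by exactly N, both interiors fit in that of V_2N and no site of one neighbours a
    site of the other. *)
Definition shiftpt N x : nat * nat := (N + x.1, N + x.2)%N.

Definition corners (I J : Type) N (p : I -> nat * nat) (q : J -> nat * nat)
    (s : I + J) : nat * nat :=
  match s with inl i => p i | inr j => shiftpt N (q j) end.

(** The sum [w] of the two small potentials is the orthogonal projection of the large potential [u]
    onto functions supported in the two small interiors, since both have the same Laplacian there.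
    Projection lowers the energy, and by [dirichlet_potential] the two energies are 4 times the
    quadratic forms compared. *)
Lemma green_block_le (I J : finType) N (p : I -> nat * nat) (q : J -> nat * nat)
    (c : I + J -> R) : (forall i, (p i).1 <= N)%N ->
  \sum_s \sum_t c s * c t * block (fun i i' => green N (p i) (p i'))
                                  (fun j j' => green N (q j) (q j')) s t <=
  \sum_s \sum_t c s * c t * green (N + N) (corners N p q s) (corners N p q t).
Proof.
move=> pN; set r := corners N p q; set K := (N + N)%N.
pose a i := c (inl i); pose b j := c (inr j).
pose u := potential K r c.
(* Truncated subtraction sends every site left of or below the second square to a zero coordinate,
   off the interior, so [w2] vanishes there. *)
pose unshift x : nat * nat := (x.1 - N, x.2 - N)%N.
pose w1 := potential N p a; pose w2 x := potential N q b (unshift x).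
pose w x := w1 x + w2 x.
have w1N : vanish_off N w1 by exact: potential_vanish.
have w2N x : ~~ Defs.interior N (unshift x) -> w2 x = 0.
  by move=> h; rewrite /w2 potential_vanish.
have w1_right x : (N <= x.1)%N -> w1 x = 0.
  by move=> h; apply: w1N; rewrite /Defs.interior; apply/negP => /and4P[*]; lia.
have w2_left x : (x.1 <= N)%N -> w2 x = 0.
  by move=> h; apply: w2N; rewrite /Defs.interior /=; apply/negP => /and4P[*]; lia.
have uK : vanish_off K u by exact: potential_vanish.
have wK : vanish_off K w.
  move=> x Kx; rewrite /w w1N ?w2N ?addr0//; apply: contra Kx;
  by rewrite /Defs.interior /= => /and4P[*]; apply/and4P; rewrite /K; split; lia.
(* Off the two interiors [w] is zero; on either one, the potential of the other square vanishes at
   the site and at its neighbours. *)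
have lap_uw x : w x * lap w x = w x * lap u x.
  rewrite lapD.
  have [Nx|Nx] := boolP (Defs.interior N x).
    have x1N : (x.1 < N)%N by case/and4P: Nx.
    have Kx : Defs.interior K x.
      by move: Nx => /and4P[*]; apply/and4P; rewrite /K; split; lia.
    congr (_ * _); rewrite !lap_potential// big_sumType/=.
    rewrite [lap w2 x](_ : _ = 0); last first.
      rewrite /lap /nbrs !big_cons big_nil !w2_left ?mulr0 ?addr0 ?subr0//=; lia.
    congr (_ + _).
      apply: eq_bigr => i _; have [xp|//] := eqVneq x (p i).
      by rewrite -xp Nx Kx.
    rewrite big1// => j _; rewrite (_ : (x == _) = false) ?mulr0//.
    by apply/eqP => xE; move: x1N; rewrite xE/= ltnNge leq_addr.
  have [Nx'|Nx'] := boolP (Defs.interior N (unshift x)); last first.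
    by rewrite /w w1N// w2N// addr0 !mul0r.
  have [x1N x2N] : (N < x.1 /\ N < x.2)%N.
    by case/and4P: Nx' => /=; rewrite !subn_gt0.
  have Kx : Defs.interior K x.
    by move: Nx' => /and4P[/= *]; apply/and4P; rewrite /K; split; lia.
  congr (_ * _).
  rewrite [lap w1 x](_ : _ = 0); last first.
    rewrite /lap /nbrs !big_cons big_nil !w1_right ?mulr0 ?addr0 ?subr0//=; lia.
  have -> : lap w2 x = lap (potential N q b) (unshift x).
    rewrite /lap /nbrs !big_cons !big_nil /w2 /unshift/=.
    by rewrite !subSn ?(ltnW x1N) ?(ltnW x2N)// -!subn1 ![(_ - 1 - _)%N]subnAC.
  rewrite !lap_potential// big_sumType/=; congr (_ + _).
    rewrite big1// => i _; rewrite (_ : (x == _) = false) ?mulr0//.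
    by apply/eqP => xE; move: x1N; rewrite xE/= ltnNge pN.
  apply: eq_bigr => j _; congr (_ * (_ * _%:R)).
  have -> : (x == shiftpt N (q j)) = (unshift x == q j).
    apply/eqP/eqP => [->|<-].
      by rewrite /unshift /shiftpt/= !addKn; case: (q j).
    by rewrite /unshift /shiftpt/= !subnKC ?(ltnW x1N) ?(ltnW x2N)//; case: (x).
  have [<-|//] := eqVneq (unshift x) (q j).
  rewrite (_ : shiftpt N (unshift x) = x) ?Kx ?Nx'//.
  by rewrite /shiftpt/= !subnKC ?(ltnW x1N) ?(ltnW x2N)// -surjective_pairing.
have Dww : dirichlet K u w = dirichlet K w w.
  rewrite !dirichletE//; apply: eq_bigr => i _; apply: eq_bigr => j _.
  by rewrite lap_uw.
have : dirichlet K w w <= dirichlet K u u.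
  have := dirichlet_ge0 K (fun x => u x - w x).
  rewrite dirichletBl [X in X - _]dirichletC [X in _ - X]dirichletC !dirichletBl.
  by rewrite (dirichletC K w u) Dww subrr subr0 subr_ge0.
rewrite -Dww !dirichlet_potential// ler_pM2l//.
have quad (C : I + J -> I + J -> R) (f : I + J -> R) :
    (forall s, f s = \sum_t c t * C s t) ->
    \sum_s \sum_t c s * c t * C s t = \sum_s c s * f s.
  move=> fE; apply: eq_bigr => s _; rewrite fE mulr_sumr.
  by apply: eq_bigr => t _; rewrite mulrA.
rewrite (quad _ (fun s => w (r s))); last first.
  case=> [i|j]; rewrite big_sumType/= /w.
    rewrite w2_left// addr0 [X in _ = _ + X]big1 ?addr0// => j _.
    by rewrite mulr0.
  rewrite w1_right ?leq_addr// add0r [X in _ = X + _]big1 ?add0r; last first.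
    by move=> i _; rewrite mulr0.
  by rewrite /w2 /unshift/= !addKn -surjective_pairing.
by rewrite (quad _ (fun s => u (r s))).
Qed.

End green_comparison.

(** * Gram decomposition of positive semidefinite forms *)

Section gram.
Context {R : rcfType} {I : finType}.
Implicit Types (D : I -> I -> R) (c : I -> R).

Definition quad D c : R := \sum_i \sum_j c i * c j * D i j.

Lemma quad_add_delta D c i t : (forall j k, D j k = D k j) ->
  quad D (fun k => c k + t * (k == i)%:R) =
  quad D c + 2 * t * (\sum_j c j * D i j) + t ^+ 2 * D i i.
Proof.
move=> Dsym.
have delta (F : I -> R) : \sum_k (k == i)%:R * F k = F i.
  rewrite (bigD1 i)//= eqxx mul1r big1 ?addr0// => k /negbTE ->.
  by rewrite mul0r.
transitivity (\sum_k ((c k * (\sum_l c l * D k l) + t * (c k * D i k)) +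
    (k == i)%:R * (t * (\sum_l c l * D k l) + t ^+ 2 * D k i))).
  apply: eq_bigr => k _.
  have -> : \sum_j (c k + t * (k == i)%:R) * (c j + t * (j == i)%:R) * D k j =
     (c k + t * (k == i)%:R) * (\sum_j c j * D k j + t * \sum_j (j == i)%:R * D k j).
    rewrite mulr_sumr -big_split mulr_sumr/=; apply: eq_bigr => j _.
    by ring.
  by rewrite delta (Dsym i k); ring.
rewrite big_split big_split/= delta -mulr_sumr.
have -> : quad D c = \sum_k c k * \sum_l c l * D k l.
  by apply: eq_bigr => k _; rewrite mulr_sumr; apply: eq_bigr => l _; rewrite mulrA.
by ring.
Qed.

(** Symmetric Gaussian elimination: subtracting the rank-one form of a nonzero pivot [D i i] leaves
    a positive semidefinite Schur complement. The induction is on the number of nonzero diagonal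
    entries: the pivot entry becomes zero, and a zero entry stays zero because it can only decrease
    while remaining nonnegative. *)
Lemma psd_gram D : (forall i j, D i j = D j i) -> (forall c, 0 <= quad D c) ->
  exists vs : seq (I -> R), forall i j, D i j = \sum_(v <- vs) v i * v j.
Proof.
have [n] := ubnP #|[pred i | D i i != 0]|.
elim: n D => // n IH D Dn Dsym Dpsd.
have quad0 D' : quad D' (fun=> 0) = 0.
  by apply: big1 => i _; apply: big1 => j _; rewrite !mul0r.
have diag D' i : (forall i j, D' i j = D' j i) -> (forall c, 0 <= quad D' c) ->
    0 <= D' i i.
  move=> D'sym D'psd.
  have := D'psd (fun k => 0 + 1 * (k == i)%:R).
  rewrite quad_add_delta// quad0 big1 => [|j _]; last by rewrite mul0r.
  by rewrite mulr0 !add0r expr1n mul1r.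
have [i /= Dii|D0] := pickP [pred i | D i i != 0]; last first.
  exists [::] => i j; rewrite big_nil.
  have Dk0 k : D k k = 0 by have /negbFE/eqP := D0 k.
  (* With a zero diagonal the form at e_j + t e_i is linear in t, and the two signs of t force
     [D i j] to vanish. *)
  have h t : 0 <= 2 * t * D i j.
    have := Dpsd (fun k => (0 + 1 * (k == j)%:R) + t * (k == i)%:R).
    rewrite !quad_add_delta// quad0 !Dk0 !mulr0 !addr0.
    rewrite big1 => [|k _]; last by rewrite mul0r.
    rewrite mulr0 !add0r (bigD1 j)//= eqxx big1 => [|k /negbTE ->].
      by rewrite addr0 add0r !mul1r.
    by rewrite mulr0 addr0 mul0r.
  by apply/eqP; rewrite eq_le; have := h 1; have := h (-1); lra.
have Dii_gt0 : 0 < D i i by rewrite lt_def Dii diag.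
pose v j := D i j / Num.sqrt (D i i).
have vv j k : v j * v k = D i j * D i k / D i i.
  rewrite /v mulrACA -invfM -expr2 sqr_sqrtr//; exact: ltW.
pose D' j k := D j k - v j * v k.
have D'sym j k : D' j k = D' k j by rewrite /D' Dsym mulrC.
have D'psd c : 0 <= quad D' c.
  pose s := \sum_j c j * D i j.
  (* This multiple of e_i minimises the form of [D] along c + t e_i, and the minimum is the form of
     [D'] at c. *)
  have := Dpsd (fun k => c k + (- (s / D i i)) * (k == i)%:R).
  rewrite quad_add_delta// -/s => /le_trans; apply; rewrite le_eqVlt; apply/orP; left.
  apply/eqP; have -> : quad D' c = quad D c - s ^+ 2 / D i i.
    rewrite /quad /D'.
    under [LHS]eq_bigr do (under eq_bigr do rewrite mulrBr; rewrite sumrB).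
    rewrite sumrB; congr (_ - _).
    transitivity (\sum_j c j * D i j * (s / D i i)).
      apply: eq_bigr => j _; rewrite /s mulr_suml mulr_sumr.
      by apply: eq_bigr => k _; rewrite vv; ring.
    by rewrite -mulr_suml -/s expr2 mulrA.
  by field.
have D'ii : D' i i = 0 by rewrite /D' vv mulfK ?subrr.
have [|vs vsE] := IH D' _ D'sym D'psd.
  rewrite -ltnS (leq_trans _ Dn)// ltnS; apply: proper_card; apply/properP; split.
    apply/fintype.subsetP => k; rewrite !inE; apply: contra => /eqP Dkk.
    by rewrite eq_le diag// andbT /D' Dkk sub0r oppr_le0 -expr2 sqr_ge0.
  by exists i; rewrite !inE ?Dii// D'ii eqxx.
by exists (v :: vs) => j k; rewrite big_cons -vsE /D' addrC subrK.
Qed.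

End gram.

(** * Normal laws *)

Section normal.
Context {R : realType}.
Local Notation mu := (@lebesgue_measure R).

Lemma integral_normal_prob (m s : R) (f : R -> \bar R) :
  measurable_fun setT f -> (forall x, 0 <= f x)%E ->
  (\int[normal_prob m s]_x f x = \int[mu]_x (f x * (normal_pdf m s x)%:E))%E.
Proof.
move=> mf f0; have nm := normal_prob_dominates m s.
rewrite -(Radon_Nikodym_SigmaFinite.change_of_variables nm)//.
have mg := Radon_Nikodym_SigmaFinite.f_integrable nm.
apply: ae_eq_integral => //.
- by apply: emeasurable_funM => //; exact: measurable_int mg.
- apply: emeasurable_funM => //; apply/measurable_EFinP.
  exact: measurable_normal_pdf.
- apply: ae_eqe_mul2l; apply: integral_ae_eq => //.
  + by apply/measurable_EFinP; exact: measurable_normal_pdf.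
  + move=> E _ mE; rewrite -(Radon_Nikodym_SigmaFinite.f_integral nm)//.
Qed.

(** Completing the square: the weight e^x turns the centered density into e^(s^2/2) times the
    density of mean s^2. *)
Lemma normal_prob_expR (s : R) : s != 0 ->
  (\int[normal_prob 0 s]_x (expR x)%:E = (expR (s ^+ 2 / 2))%:E)%E.
Proof.
move=> s0; rewrite integral_normal_prob; first last.
- by move=> x; rewrite lee_fin expR_ge0.
- by apply/measurable_EFinP; exact: measurable_expR.
transitivity (\int[mu]_x ((expR (s ^+ 2 / 2))%:E * (normal_pdf (s ^+ 2) s x)%:E))%E.
  apply: eq_integral => x _; rewrite -!EFinM; congr EFin.
  rewrite !normal_pdfE// /normal_fun mulrCA [RHS]mulrCA; congr (_ * _).
  by rewrite -!expRD; congr expR; field.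
rewrite integralZl//; last exact: integrable_normal_pdf.
by rewrite integral_normal_pdf mule1.
Qed.

Lemma lebesgue_measure_shift (c : R) (A : set R) : measurable A ->
  mu [set x | A (x + c)] = mu A.
Proof.
move=> mA.
have mf : measurable_fun [set: measurableTypeR R]
    (fun x : measurableTypeR R => x + c : measurableTypeR R).
  exact: measurable_funD.
rewrite -[LHS]/(pushforward mu (fun x : measurableTypeR R => x + c : measurableTypeR R) A).
apply/esym; apply: (@lebesgue_measure_unique R (pushforward mu
  (fun x : measurableTypeR R => x + c : measurableTypeR R))) => // X [[a b]/= _ <-].
rewrite /pushforward.
have -> : (fun x => x + c) @^-1` `]a, b]%classic = `]a - c, b - c]%classic.
  by apply/seteqP; split => x; rewrite /= !in_itv/= ltrBlDr lerBrDr.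
rewrite !lebesgue_measure_itv/= !lte_fin ltrD2r; case: ifP => // _.
by rewrite -!EFinD; congr EFin; ring.
Qed.

Lemma integral_shift (c : R) (f : R -> \bar R) :
  measurable_fun setT f -> (forall x, 0 <= f x)%E ->
  (\int[mu]_x f (x + c)%R = \int[mu]_x f x)%E.
Proof.
move=> mf f0.
have ms : measurable_fun [set: measurableTypeR R]
    (fun x : measurableTypeR R => x + c : measurableTypeR R).
  exact: measurable_funD.
rewrite -[LHS](@ge0_integral_pushforward _ _ _ _ _ _ ms mu setT f)//.
apply: eq_measure_integral => A mA _.
by rewrite -[RHS](lebesgue_measure_shift c mA).
Qed.

Lemma normal_pdf_conv (s t z : R) : s != 0 -> t != 0 ->
  (\int[mu]_x (normal_pdf 0 t (z - x) * normal_pdf 0 s x)%:E =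
   (normal_pdf 0 (Num.sqrt (s ^+ 2 + t ^+ 2)) z)%:E)%E.
Proof.
move=> s0 t0.
have s2 : 0 < s ^+ 2 by rewrite exprn_even_gt0.
have t2 : 0 < t ^+ 2 by rewrite exprn_even_gt0.
have st : 0 < s ^+ 2 + t ^+ 2 by rewrite addr_gt0.
have sq : Num.sqrt (s ^+ 2 + t ^+ 2) != 0 by rewrite gt_eqF// sqrtr_gt0.
(* As a function of x the integrand is a multiple of a normal density; [m] and [r] are the
   conditional mean and standard deviation of the first variable given that the sum is z. *)
pose r := Num.sqrt (s ^+ 2 * t ^+ 2 / (s ^+ 2 + t ^+ 2)).
have r0 : r != 0 by rewrite gt_eqF// sqrtr_gt0 divr_gt0// mulr_gt0.
pose m := z * s ^+ 2 / (s ^+ 2 + t ^+ 2).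
have r2 : r ^+ 2 = s ^+ 2 * t ^+ 2 / (s ^+ 2 + t ^+ 2).
  by rewrite sqr_sqrtr// ltW// divr_gt0// mulr_gt0.
transitivity (\int[mu]_x ((normal_pdf 0 (Num.sqrt (s ^+ 2 + t ^+ 2)) z)%:E *
    (normal_pdf m r x)%:E))%E; last first.
  rewrite integralZl//; last exact: integrable_normal_pdf.
  by rewrite integral_normal_pdf mule1.
apply: eq_integral => x _; rewrite -EFinM; congr EFin.
rewrite !normal_pdfE// mulrACA [RHS]mulrACA; congr (_ * _).
  rewrite /normal_peak -!invfM -!sqrtrM; last 2 first.
    by rewrite mulrn_wge0// mulr_ge0 ?pi_ge0// sqr_ge0.
    by rewrite mulrn_wge0// mulr_ge0 ?pi_ge0// sqr_ge0.
  rewrite r2 sqr_sqrtr ?(ltW st)//; congr (Num.sqrt _)^-1.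
  by field; rewrite gt_eqF.
rewrite /normal_fun -!expRD r2 sqr_sqrtr ?(ltW st)//; congr expR; rewrite /m.
by field; rewrite gt_eqF//= s0 t0.
Qed.

Lemma normal_prob_conv (s t : R) (A : set R) : s != 0 -> t != 0 -> measurable A ->
  (\int[normal_prob 0 s]_x normal_prob 0 t [set y | A (x + y)%R] =
   normal_prob 0 (Num.sqrt (s ^+ 2 + t ^+ 2)) A)%E.
Proof.
move=> s0 t0 mA.
pose g (x z : R) := normal_pdf 0 t (z - x) * \1_A z.
have g0 x z : 0 <= g x z by rewrite mulr_ge0 ?normal_pdf_ge0.
have mg2 : measurable_fun [set: measurableTypeR R * measurableTypeR R] (fun p => g p.1 p.2).
  apply: measurable_funM.
    apply: (measurableT_comp (measurable_normal_pdf 0 t)).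
    exact: measurable_funB.
  exact: (measurableT_comp (measurable_indic mA)).
pose h (p : measurableTypeR R * measurableTypeR R) := (g p.1 p.2 * normal_pdf 0 s p.1)%:E.
have mh : measurable_fun setT h.
  apply/measurable_EFinP; apply: measurable_funM => //.
  exact: (measurableT_comp (measurable_normal_pdf 0 s)).
have gE x : normal_prob 0 t [set y | A (x + y)] = (\int[mu]_z (g x z)%:E)%E.
  rewrite /normal_prob integral_mkcond epatch_indic.
  rewrite -(integral_shift x) => [| |y]; last 2 first.
  - apply/measurable_EFinP.
    exact: (measurableT_comp mg2 (measurable_pair1 x)).
  - by rewrite lee_fin.
  apply: eq_integral => y _; rewrite -EFinM; congr EFin; rewrite /g addrK.
  congr (_ * _); rewrite !indicE; congr (nat_of_bool _)%:R.
  by apply/idP/idP => /set_mem/= Ayx; apply/mem_set => /=; rewrite addrC.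
under eq_integral do rewrite gE.
rewrite integral_normal_prob; last 2 first.
- have mgE : measurable_fun [set: measurableTypeR R * measurableTypeR R]
      (fun p : measurableTypeR R * measurableTypeR R => (g p.1 p.2)%:E).
    exact/measurable_EFinP.
  apply: (measurable_fun_fubini_tonelli_F (m2 := mu) _ mgE) => p.
  by rewrite lee_fin.
- by move=> x; apply: integral_ge0 => z _; rewrite lee_fin.
transitivity (\int[mu]_x \int[mu]_z h (x, z))%E.
  apply: eq_integral => x _; rewrite -ge0_integralZr//.
  - apply/measurable_EFinP.
    exact: (measurableT_comp mg2 (measurable_pair1 x)).
  - by move=> z _; rewrite lee_fin.
  - by rewrite lee_fin normal_pdf_ge0.
rewrite (fubini_tonelli (m1 := mu) (m2 := mu) _ mh) => [|p]; last first.
  by rewrite lee_fin mulr_ge0 ?normal_pdf_ge0.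
rewrite /normal_prob [RHS]integral_mkcond epatch_indic.
apply: eq_integral => z _.
transitivity ((\1_A z)%:E * \int[mu]_x (normal_pdf 0 t (z - x) * normal_pdf 0 s x)%:E)%E.
  rewrite -ge0_integralZl//.
  - by apply: eq_integral => x _; rewrite -EFinM /h /g/=; congr EFin; ring.
  - apply/measurable_EFinP; apply: measurable_funM.
      apply: (measurableT_comp (measurable_normal_pdf 0 t)).
      exact: measurable_funB.
    exact: measurable_normal_pdf.
  - by move=> x _; rewrite lee_fin mulr_ge0 ?normal_pdf_ge0.
by rewrite normal_pdf_conv// muleC.
Qed.

End normal.

(** * Gaussian vectors *)

Section gaussian_law.
Context {R : realType}.

(* the degenerate [normal_prob 0 0] of the library is a uniform law, so the
   variance [0] has to be singled out *)
Definition gauss (q : R) : probability (measurableTypeR R) R :=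
  if q == 0 then (\d_(0 : measurableTypeR R) : probability (measurableTypeR R) R)
  else (normal_prob 0 (Num.sqrt q) : probability (measurableTypeR R) R).

Lemma measurable_addl (A : set R) (x : R) : measurable A -> measurable [set y | A (x + y)].
Proof.
move=> mA.
have mD : measurable_fun [set: measurableTypeR R]
    (fun y : measurableTypeR R => x + y : measurableTypeR R).
  exact: measurable_funD.
by rewrite -[X in measurable X]setTI; exact: mD.
Qed.

Lemma measurable_add_set (A : set R) : measurable A ->
  measurable [set w : measurableTypeR R * measurableTypeR R | A (w.1 + w.2)].
Proof.
move=> mA.
have mD : measurable_fun [set: measurableTypeR R * measurableTypeR R]
    (fun w : measurableTypeR R * measurableTypeR R => w.1 + w.2 : measurableTypeR R).
  exact: measurable_funD.
by rewrite -[X in measurable X]setTI; exact: mD.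
Qed.

Lemma measurable_fun_conv (nu : probability (measurableTypeR R) R) (A : set R) :
  measurable A ->
  measurable_fun [set: measurableTypeR R] (fun x => nu [set y | A (x + y)]).
Proof.
move=> mA; rewrite (_ : (fun x => _) = nu \o xsection
    [set w : measurableTypeR R * measurableTypeR R | A (w.1 + w.2)]).
  exact: (measurable_fun_xsection nu (measurable_add_set mA)).
apply/funext => x /=; congr (nu _); apply/seteqP; split => y.
  by move=> Axy; apply/xsectionP.
by move=> /xsectionP.
Qed.

Lemma gauss_conv (p q : R) (A : set R) : 0 <= p -> 0 <= q -> measurable A ->
  (\int[gauss p]_x gauss q [set y | A (x + y)%R] = gauss (p + q) A)%E.
Proof.
move=> p0 q0 mA.
have [->|pn0] := eqVneq p 0.
  rewrite add0r {1}/gauss eqxx integral_dirac//; last exact: measurable_fun_conv.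
  rewrite diracT mul1e; congr (gauss q _).
  by apply/seteqP; split => y /=; rewrite add0r.
have [->|qn0] := eqVneq q 0.
  rewrite addr0.
  transitivity (\int[gauss p]_x (\1_A x)%:E)%E.
    apply: eq_integral => x _; rewrite /gauss eqxx/= diracE indicE.
    congr (nat_of_bool _)%:R%:E.
    by apply/idP/idP => /set_mem/= Ax; apply/mem_set => /=; rewrite addr0 in Ax *.
  by rewrite integral_indic// setIT.
rewrite /gauss paddr_eq0// (negbTE pn0) (negbTE qn0)/=.
rewrite normal_prob_conv ?sqr_sqrtr//.
  by rewrite gt_eqF// sqrtr_gt0 lt_def pn0.
by rewrite gt_eqF// sqrtr_gt0 lt_def qn0.
Qed.

Lemma gauss_expR (q : R) : 0 <= q ->
  (\int[gauss q]_x (expR x)%:E = (expR (q / 2))%:E)%E.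
Proof.
move=> q0; rewrite /gauss; case: eqVneq => [->|qn0].
  rewrite integral_dirac//; first by rewrite mul0r diracT mul1e expR0.
  by apply/measurable_EFinP; exact: measurable_expR.
by rewrite normal_prob_expR ?sqr_sqrtr// gt_eqF// sqrtr_gt0 lt_def qn0.
Qed.

Definition has_law d (T : measurableType d) (P : probability T R) (Z : T -> R)
    (nu : probability (measurableTypeR R) R) :=
  forall A : set R, measurable A -> P (Z @^-1` A) = nu A.

Lemma ge0_has_law_integral d (T : measurableType d) (P : probability T R) (Z : T -> R)
    (nu : probability (measurableTypeR R) R) (f : R -> \bar R) :
  measurable_fun setT Z -> has_law P Z nu -> measurable_fun setT f ->
  (forall x, 0 <= f x)%E -> (\int[P]_w f (Z w) = \int[nu]_x f x)%E.
Proof.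
move=> mZ lZ mf f0.
have mZ' : measurable_fun setT (Z : T -> measurableTypeR R) by [].
rewrite -[LHS](@ge0_integral_pushforward _ _ _ _ _ _ mZ' P setT f)//.
by apply: eq_measure_integral => A mA _; exact: lZ.
Qed.

Lemma has_law_add d1 (T1 : measurableType d1) (P1 : probability T1 R)
    d2 (T2 : measurableType d2) (P2 : probability T2 R) (Z1 : T1 -> R) (Z2 : T2 -> R) p q :
  0 <= p -> 0 <= q -> measurable_fun setT Z1 -> measurable_fun setT Z2 ->
  has_law P1 Z1 (gauss p) -> has_law P2 Z2 (gauss q) ->
  has_law (P1 \x P2)%E (fun w => Z1 w.1 + Z2 w.2) (gauss (p + q)).
Proof.
move=> p0 q0 mZ1 mZ2 lZ1 lZ2 A mA; rewrite -gauss_conv//.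
transitivity (\int[P1]_x P2 (xsection ((fun w : T1 * T2 => (Z1 w.1 + Z2 w.2)%R) @^-1` A) x))%E.
  by [].
transitivity (\int[P1]_x (gauss q [set y | A (Z1 x + y)%R]))%E.
  apply: eq_integral => x _; rewrite -lZ2; last exact: measurable_addl.
  by congr (P2 _); rewrite xsectionE.
rewrite -(ge0_has_law_integral mZ1 lZ1)//; exact: measurable_fun_conv.
Qed.

End gaussian_law.

Section gaussian_vector.
Context {R : realType}.

Definition lincomb (I : finType) T (a : I -> R) (X : I -> T -> R) (w : T) : R :=
  \sum_i a i * X i w.

(** Nonnegativity of the variances is recorded because [Num.sqrt] sends a negative number to 0, for
    which [gauss] would not be a normal law. *)
Definition gaussian_vector d (T : measurableType d) (P : probability T R)
    (I : finType) (C : I -> I -> R) (X : I -> T -> R) :=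
  [/\ forall i, measurable_fun setT (X i), forall a, 0 <= quad C a &
      forall a, has_law P (lincomb a X) (gauss (quad C a))].

Lemma measurable_lincomb d (T : measurableType d) (I : finType) (a : I -> R)
    (X : I -> T -> R) :
  (forall i, measurable_fun setT (X i)) -> measurable_fun setT (lincomb a X).
Proof.
move=> mX; apply: measurable_sum => i.
by apply: measurable_funM => //; exact: measurable_cst.
Qed.

Lemma centered_gaussian_vector d (T : measurableType d) (P : probability T R)
    (I : finType) (C : I -> I -> R) (X : I -> T -> R) :
  (forall a, 0 <= quad C a) -> centered_gaussian P C X -> gaussian_vector P C X.
Proof.
move=> C0 [mX lX]; split=> // a A mA; have /= := lX a.
rewrite -/(quad C a) -/(lincomb a X) /gauss; case: ifP => [_ S0|_]; last exact.
have mS := measurable_lincomb a mX.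
have mN : measurable [set w | lincomb a X w != 0].
  rewrite (_ : mkset _ = lincomb a X @^-1` (~` [set 0])).
    by rewrite -[X in measurable X]setTI; apply: mS => //; exact: measurableC.
  by apply/seteqP; split => w /= /eqP.
have mSA B : measurable B -> measurable (lincomb a X @^-1` B).
  by move=> mB; rewrite -[X in measurable X]setTI; exact: mS.
have null (B : set R) : measurable B -> ~ B (0 : R) -> P (lincomb a X @^-1` B) = 0%E.
  move=> mB B0; apply/eqP; rewrite eq_le measure_ge0 andbT -S0.
  apply: le_measure; rewrite ?inE//; first exact: mSA.
  by move=> w /= Bw; apply/eqP => w0; apply: B0; rewrite -w0.
rewrite [RHS]/= diracE; have [A0|A0] := pselect (A 0); last by rewrite memNset ?null.
rewrite mem_set//=.
rewrite -[_ @^-1` A]setCK probability_setC; last exact/measurableC/mSA.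
by rewrite preimage_setC null ?sube0//; exact: measurableC.
Qed.

Lemma gaussian_vector_pair d1 (T1 : measurableType d1) (P1 : probability T1 R)
    d2 (T2 : measurableType d2) (P2 : probability T2 R) (I J : finType)
    (C : I -> I -> R) (D : J -> J -> R) (X : I -> T1 -> R) (Y : J -> T2 -> R) :
  gaussian_vector P1 C X -> gaussian_vector P2 D Y ->
  gaussian_vector (P1 \x P2)%E (block C D)
    (fun s w => match s with inl i => X i w.1 | inr j => Y j w.2 end).
Proof.
move=> [mX C0 lX] [mY D0 lY].
have qE a : quad (block C D) a = quad C (a \o inl) + quad D (a \o inr).
  rewrite /quad big_sumType/=; congr (_ + _).
    apply: eq_bigr => i _; rewrite big_sumType/= [X in _ + X]big1 ?addr0// => j _.
    by rewrite mulr0.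
  apply: eq_bigr => j _; rewrite big_sumType/= big1 ?add0r// => i _.
  by rewrite mulr0.
split.
- case=> [i|j]; first exact: (measurableT_comp (mX i) measurable_fst).
  exact: (measurableT_comp (mY j) measurable_snd).
- by move=> a; rewrite qE addr_ge0.
- move=> a; rewrite qE.
  rewrite (_ : lincomb _ _ = (fun w => lincomb (a \o inl) X w.1 + lincomb (a \o inr) Y w.2)).
    by apply: has_law_add => //; exact: measurable_lincomb.
  by apply/funext => w; rewrite /lincomb big_sumType.
Qed.

Definition congruence (I J : finType) (B : J -> I -> R) (C : I -> I -> R) (j k : J) : R :=
  \sum_i \sum_l B j i * B k l * C i l.

Lemma gaussian_vector_linear d (T : measurableType d) (P : probability T R)
    (I J : finType) (C : I -> I -> R) (X : I -> T -> R) (B : J -> I -> R) :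
  gaussian_vector P C X ->
  gaussian_vector P (congruence B C) (fun j => lincomb (B j) X).
Proof.
move=> [mX C0 lX].
have qE a : quad (congruence B C) a = quad C (fun i => \sum_j a j * B j i).
  rewrite /quad /congruence.
  under eq_bigr do under eq_bigr do
    (rewrite mulr_sumr; under eq_bigr do rewrite mulr_sumr).
  under [RHS]eq_bigr do under eq_bigr do
    (rewrite mulr_suml mulr_suml; under eq_bigr do rewrite mulr_sumr mulr_suml).
  under eq_bigr do (rewrite exchange_big/=; under eq_bigr do rewrite exchange_big/=).
  rewrite exchange_big/=; apply: eq_bigr => i _.
  rewrite exchange_big/=; apply: eq_bigr => l _.
  by apply: eq_bigr => j _; apply: eq_bigr => k _; ring.
split=> [j|a|a].
- exact: measurable_lincomb.
- by rewrite qE.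
- rewrite qE (_ : lincomb _ _ = lincomb (fun i => \sum_j a j * B j i) X)//.
  apply/funext => w; rewrite /lincomb.
  under eq_bigr do rewrite mulr_sumr.
  rewrite exchange_big/=; apply: eq_bigr => i _; rewrite mulr_suml.
  by apply: eq_bigr => j _; rewrite mulrA.
Qed.

End gaussian_vector.

(** * Bounded convergence and exponential limits *)

Lemma bounded_integrable d (T : measurableType d) (R : realType) (P : probability T R)
    (f : T -> R) (B : R) : measurable_fun setT f -> (forall w, `|f w| <= B) ->
  P.-integrable setT (EFin \o f).
Proof.
move=> mf fB; apply: measurable_bounded_integrable => //.
  by rewrite (le_lt_trans (probability_le1 _ _)) ?ltry.
exists B; split; first exact: num_real.
by move=> M BM w _; exact: le_trans (fB w) (ltW BM).
Qed.

Lemma bounded_convergence d (T : measurableType d) (R : realType) (P : probability T R)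
    (f_ : nat -> T -> R) (f : T -> R) (B : R) :
  (forall n, measurable_fun setT (f_ n)) -> (forall n w, `|f_ n w| <= B) ->
  (forall w, f_ n w @[n --> \oo] --> f w) ->
  measurable_fun setT f /\
  \int[P]_w f_ n w @[n --> \oo] --> \int[P]_w f w.
Proof.
move=> mf_ fB cf.
have mf : measurable_fun setT f by apply: (measurable_fun_cvg mf_) => w _; exact: cf.
split => //.
have [] := @dominated_convergence _ _ _ P _ measurableT (fun n => EFin \o f_ n)
   (EFin \o f) (cst B%:E).
- by move=> n; apply/measurable_EFinP.
- exact/measurable_EFinP.
- by apply: aeW => w _; apply/cvg_EFin; [exact: nearW|exact: cf].
- exact: finite_measure_integrable_cst.
- by apply: aeW => w n _ /=; rewrite lee_fin.
move=> fi _ h; apply: fine_cvg; rewrite /Rintegral fineK//.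
exact: integrable_fin_num.
Qed.

Section exponential_limits.
Context {R : realType}.

Lemma cvg_expR_partial (x : R) :
  \sum_(k < n) k`!%:R^-1 * x ^+ k @[n --> \oo] --> expR x.
Proof.
have -> : (fun n => \sum_(k < n) k`!%:R^-1 * x ^+ k) = series (exp_coeff x).
  apply/funext => n; rewrite /series/= big_mkord; apply: eq_bigr => k _.
  by rewrite /exp_coeff/= mulrC.
exact: is_cvg_series_exp_coeff.
Qed.

Lemma expR_partial_le (x B : R) n : `|x| <= B ->
  `|\sum_(k < n) k`!%:R^-1 * x ^+ k| <= expR B.
Proof.
move=> xB; apply: (@le_trans _ _ (expR `|x|)); last by rewrite ler_expR.
apply: (@le_trans _ _ (\sum_(k < n) k`!%:R^-1 * `|x| ^+ k)).
  apply: le_trans (ler_norm_sum _ _ _) _; apply: ler_sum => k _.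
  by rewrite normrM normrX ger0_norm// invr_ge0.
have cv := @cvg_expR_partial `|x|.
rewrite -(cvg_lim _ cv)//.
apply: (nondecreasing_cvgn_le (u_ := fun n => \sum_(k < n) k`!%:R^-1 * `|x| ^+ k)).
  apply/nondecreasing_seqP => m; rewrite big_ord_recr/= lerDl.
  by rewrite mulr_ge0// ?invr_ge0// exprn_ge0.
by apply/cvg_ex; eexists; exact: cv.
Qed.

Lemma cvg_nsin (x : R) : k.+1%:R * sin (k.+1%:R^-1 * x) @[k --> \oo] --> x.
Proof.
pose f (h : R) := sin (h * x).
have df : is_derive (0 : R) 1 f x.
  have -> : f = sin \o (fun h : R => h * x) by [].
  apply: is_derive_eq.
  by rewrite mul0r cos0 scale0r add0r mul1r /GRing.scale/= mulr1.
have cf : h^-1 *: ((f \o shift 0) (h *: (1 : R)) - f 0) @[h --> (0 : R)^'] --> x.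
  have [fd fx] := df; rewrite -[X in _ --> X]fx.
  exact: fd.
have hn : k.+1%:R^-1 @[k --> \oo] --> (0 : R)^'.
  move=> A /= [e /= e0 eA].
  have := @cvg_harmonic R; move/cvgrPdist_lt => /(_ e e0) [N _ NA].
  exists N => // k Nk /=; apply: eA.
    by have := NA k Nk.
  by rewrite invr_eq0 pnatr_eq0.
have := cvg_comp _ _ hn cf; apply: cvg_trans; apply: near_eq_cvg; apply: nearW => k /=.
by rewrite invrK /f /shift/= addr0 mul0r sin0 subr0 /GRing.scale/= mulr1.
Qed.

(** The inner exponent tends to +oo when x > t, since n^2 dominates, and is at most -n otherwise;
    the term -n is what decides the case x = t. *)
Lemma cvg_double_exp (x t : R) :
  expR (- expR (n%:R ^+ 2 * (x - t) - n%:R)) @[n --> \oo] --> ((x <= t)%R%:R : R).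
Proof.
have bnd (u z : R) : 0 <= u -> u <= z -> expR (- z) <= (1 + u)^-1.
  move=> u0 uz; rewrite expRN lef_pV2 ?posrE ?expR_gt0 ?ltr_pwDl//.
  by apply: le_trans (expR_ge1Dx _); rewrite lerD2l.
suff : \forall n \near \oo,
    `|expR (- expR (n%:R ^+ 2 * (x - t) - n%:R)) - (x <= t)%R%:R| <= harmonic n :> R.
  move=> h; apply/(@cvgrPdist_le _ R^o) => e e0.
  have /cvgrPdist_le /(_ e e0) he := @cvg_harmonic R.
  near=> n; rewrite distrC.
  apply: (@le_trans _ _ (harmonic n)); first by near: n.
  have : `|0 - harmonic n| <= e :> R by near: n.
  by rewrite sub0r normrN; exact: le_trans (ler_norm _).
have [xt|tx] := leP x t.
  near=> n.
  set u := n%:R ^+ 2 * (x - t) - n%:R.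
  have un : u <= - n%:R.
    by rewrite /u lerBlDr addNr mulr_ge0_le0 ?sqr_ge0// subr_le0.
  have eu : expR u <= harmonic n.
    rewrite -[u]opprK /harmonic/= -nat1r; apply: bnd => //.
    by rewrite lerNr.
  rewrite distrC ger0_norm; last by rewrite subr_ge0 -expR0 ler_expR oppr_le0 expR_ge0.
  apply: le_trans eu; rewrite lerBlDl -lerBlDr; apply: le_trans (expR_ge1Dx _).
  by [].
have xt0 : 0 < x - t by rewrite subr_gt0.
near=> n.
rewrite subr0 ger0_norm ?expR_ge0// /harmonic/= -nat1r.
apply: bnd => //; apply: (@le_trans _ _ (n%:R ^+ 2 * (x - t) - n%:R)); last first.
  by apply: le_trans (expR_ge1Dx _); rewrite lerDr.
rewrite -subr_ge0 (_ : _ - _ = n%:R * (n%:R * (x - t) - 2)); last by ring.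
rewrite mulr_ge0// subr_ge0 -ler_pdivrMr//.
by near: n; exact: nbhs_infty_ger.
Unshelve. all: by end_near.
Qed.

End exponential_limits.

(** * Laws determined by linear combinations *)

Section uniqueness.
Context {R : realType} {I : finType}.
Context d (T : measurableType d) (P : probability T R) (X : I -> T -> R).
Context d' (T' : measurableType d') (P' : probability T' R) (X' : I -> T' -> R).
Implicit Types (F G : (I -> R) -> R) (a b : I -> R).

Let EX F : R := \int[P]_w F (X^~ w).
Let EX' F : R := \int[P']_w F (X'^~ w).

Definition bounded_obs F :=
  [/\ exists B, forall x, `|F x| <= B, measurable_fun setT (fun w => F (X^~ w)) &
      measurable_fun setT (fun w => F (X'^~ w))].

(** A cosine with free phase replaces the complex character of frequency [a]; the phase -pi/2 gives
    the sine. *)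
Definition wave a th (x : I -> R) : R := cos (\sum_i a i * x i + th).

(** Testing against every wave, rather than comparing the two means of [F] alone, makes the class
    stable under multiplication by a wave. *)
Definition agree F := bounded_obs F /\
  forall a th, EX (fun x => F x * wave a th x) = EX' (fun x => F x * wave a th x).

(* [agree] is only a vector space; its multipliers form an algebra, which
   contains the waves because products of waves are sums of waves *)
Definition multiplier F := bounded_obs F /\
  forall G, agree G -> agree (fun x => F x * G x).

Context (mX : forall i, measurable_fun setT (X i)).
Context (mX' : forall i, measurable_fun setT (X' i)).
Context (same_law : forall a A, measurable A ->
  P (lincomb a X @^-1` A) = P' (lincomb a X' @^-1` A)).

Lemma bounded_obs_wave a th : bounded_obs (wave a th).
Proof.
split; first by exists 1 => x; rewrite ler_norml cos_geN1 cos_le1.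
  apply: (measurableT_comp (@continuous_measurable_fun _ _ (@continuous_cos R))).
  by apply: measurable_funD => //; exact: measurable_lincomb.
apply: (measurableT_comp (@continuous_measurable_fun _ _ (@continuous_cos R))).
by apply: measurable_funD => //; exact: measurable_lincomb.
Qed.

Lemma bounded_obsM F G : bounded_obs F -> bounded_obs G ->
  bounded_obs (fun x => F x * G x).
Proof.
move=> [[B FB] mF mF'] [[C GC] mG mG']; split; last 2 first.
- exact: measurable_funM.
- exact: measurable_funM.
- by exists (B * C) => x; rewrite normrM ler_pM.
Qed.

Lemma bounded_obs_comb F G c : bounded_obs F -> bounded_obs G ->
  bounded_obs (fun x => F x + c * G x).
Proof.
move=> [[B FB] mF mF'] [[C GC] mG mG']; split; last 2 first.
- by apply: measurable_funD => //; apply: measurable_funM.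
- by apply: measurable_funD => //; apply: measurable_funM.
- exists (B + `|c| * C) => x; apply: le_trans (ler_normD _ _) _.
  by rewrite lerD// normrM ler_wpM2l.
Qed.

Lemma bounded_obs_lim (F_ : nat -> (I -> R) -> R) F B :
  (forall n, bounded_obs (F_ n)) -> (forall n x, `|F_ n x| <= B) ->
  (forall x, F_ n x @[n --> \oo] --> F x) ->
  [/\ bounded_obs F, EX (F_ n) @[n --> \oo] --> EX F & EX' (F_ n) @[n --> \oo] --> EX' F].
Proof.
move=> bF FB cF.
have [mF eF] := @bounded_convergence _ _ _ P
  (fun n w => F_ n (X^~ w)) (fun w => F (X^~ w)) B
  (fun n => let: And3 _ h _ := bF n in h) (fun n w => FB n _) (fun w => cF _).
have [mF' eF'] := @bounded_convergence _ _ _ P'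
  (fun n w => F_ n (X'^~ w)) (fun w => F (X'^~ w)) B
  (fun n => let: And3 _ _ h := bF n in h) (fun n w => FB n _) (fun w => cF _).
split=> //; split=> //; exists B => x.
have cn : `|F_ n x| @[n --> \oo] --> `|F x| by apply: cvg_norm; exact: cF.
rewrite -(cvg_lim _ cn)//; apply: limr_le; first by apply/cvg_ex; eexists; exact: cn.
exact: nearW.
Qed.

Lemma bounded_obs_integrable F : bounded_obs F ->
  P.-integrable setT (EFin \o (fun w => F (X^~ w))) /\
  P'.-integrable setT (EFin \o (fun w => F (X'^~ w))).
Proof.
move=> [[B FB] mF mF']; split; apply: (@bounded_integrable _ _ _ _ _ B) => //.
Qed.

Lemma EX_comb F G c : bounded_obs F -> bounded_obs G ->
  (EX (fun x => F x + c * G x) = EX F + c * EX G) *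
  (EX' (fun x => F x + c * G x) = EX' F + c * EX' G).
Proof.
move=> bF bG; have [iF iF'] := bounded_obs_integrable bF.
have [iG iG'] := bounded_obs_integrable bG.
split; rewrite /EX /EX' RintegralD//= ?RintegralZl//.
  exact: (@integrableZl _ _ _ _ _ measurableT c _ iG).
exact: (@integrableZl _ _ _ _ _ measurableT c _ iG').
Qed.

Lemma agree_comb F G c : agree F -> agree G -> agree (fun x => F x + c * G x).
Proof.
move=> [bF aF] [bG aG]; split; first exact: bounded_obs_comb.
move=> a th.
have -> : (fun x => (F x + c * G x) * wave a th x) =
    (fun x => F x * wave a th x + c * (G x * wave a th x)).
  by apply/funext => x; ring.
have bw := bounded_obs_wave a th.
have [bFw bGw] := (bounded_obsM bF bw, bounded_obsM bG bw).
by rewrite !EX_comb// aF aG.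
Qed.

Lemma agree_lim (F_ : nat -> (I -> R) -> R) F B :
  (forall n, agree (F_ n)) -> (forall n x, `|F_ n x| <= B) ->
  (forall x, F_ n x @[n --> \oo] --> F x) -> agree F.
Proof.
move=> aF FB cF; split.
  by have [] := bounded_obs_lim (fun n => (aF n).1) FB cF.
move=> a th.
have wave1 x : `|wave a th x| <= 1 by rewrite ler_norml cos_geN1 cos_le1.
have [|||_ e e'] := @bounded_obs_lim (fun n x => F_ n x * wave a th x)
  (fun x => F x * wave a th x) B.
- by move=> n; exact: bounded_obsM (aF n).1 (bounded_obs_wave a th).
- by move=> n x; rewrite normrM -[B]mulr1 ler_pM.
- by move=> x; apply: cvgMl; exact: cF.
rewrite -(cvg_lim _ e)// -(cvg_lim _ e')//; congr (limn _).
by apply/funext => n; exact: (aF n).2.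
Qed.

Lemma multiplierM F G : multiplier F -> multiplier G -> multiplier (fun x => F x * G x).
Proof.
move=> [bF mF] [bG mG]; split; first exact: bounded_obsM.
move=> H aH; rewrite (_ : (fun x => _) = (fun x => F x * (G x * H x))).
  by apply: mF; exact: mG.
by apply/funext => x; rewrite mulrA.
Qed.

Lemma multiplier_comb F G c : multiplier F -> multiplier G ->
  multiplier (fun x => F x + c * G x).
Proof.
move=> [bF mF] [bG mG]; split; first exact: bounded_obs_comb.
move=> H aH; rewrite (_ : (fun x => _) = (fun x => F x * H x + c * (G x * H x))).
  by apply: agree_comb; [exact: mF|exact: mG].
by apply/funext => x; ring.
Qed.

Lemma multiplier_lim (F_ : nat -> (I -> R) -> R) F B :
  (forall n, multiplier (F_ n)) -> (forall n x, `|F_ n x| <= B) ->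
  (forall x, F_ n x @[n --> \oo] --> F x) -> multiplier F.
Proof.
move=> mF FB cF; split.
  by have [] := bounded_obs_lim (fun n => (mF n).1) FB cF.
move=> G aG; have [[[C GC] _ _] _] := aG.
apply: (@agree_lim (fun n x => F_ n x * G x) _ (B * C)).
- by move=> n; exact: (mF n).2.
- by move=> n x; rewrite normrM ler_pM.
- by move=> x; apply: cvgMl; exact: cF.
Qed.

Lemma multiplier1 : multiplier (fun=> 1).
Proof.
split; first by split; [exists 1 => x; rewrite normr1| |].
by move=> G aG; under eq_fun do rewrite mul1r.
Qed.

Lemma multiplier_cst c : multiplier (fun=> c).
Proof.
have := multiplier_comb (c - 1) multiplier1 multiplier1.
by under eq_fun do rewrite mulr1 addrC subrK.
Qed.

Lemma multiplierZ F c : multiplier F -> multiplier (fun x => c * F x).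
Proof. by move=> mF; apply: multiplierM => //; exact: multiplier_cst. Qed.

Lemma multiplierN F : multiplier F -> multiplier (fun x => - F x).
Proof.
by move=> /(multiplierZ (-1)); under eq_fun do rewrite mulN1r.
Qed.

Lemma multiplier_wave a th : multiplier (wave a th).
Proof.
split=> [|G [bG aG]]; first exact: bounded_obs_wave.
split=> [|b ph]; first by apply: bounded_obsM => //; exact: bounded_obs_wave.
pose a1 i := b i + a i; pose a2 i := b i - a i.
pose H x := wave a th x * G x * wave b ph x.
have bH : bounded_obs H.
  apply: bounded_obsM; last exact: bounded_obs_wave.
  by apply: bounded_obsM => //; exact: bounded_obs_wave.
have HH : (fun x => H x + 1 * H x) =
    (fun x => G x * wave a1 (ph + th) x + 1 * (G x * wave a2 (ph - th) x)).
  apply/funext => x; rewrite /H /wave.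
  have -> : \sum_i a1 i * x i = \sum_i b i * x i + \sum_i a i * x i.
    by rewrite -big_split/=; apply: eq_bigr => i _; rewrite mulrDl.
  have -> : \sum_i a2 i * x i = \sum_i b i * x i - \sum_i a i * x i.
    by rewrite -sumrB/=; apply: eq_bigr => i _; rewrite mulrBl.
  move: (\sum_i b i * x i) (\sum_i a i * x i) => u v.
  have -> : u + v + (ph + th) = (u + ph) + (v + th) by ring.
  have -> : u - v + (ph - th) = (u + ph) - (v + th) by ring.
  by move: (u + ph) (v + th) => p q; rewrite cosD cosB; ring.
have b1 := bounded_obsM bG (bounded_obs_wave a1 (ph + th)).
have b2 := bounded_obsM bG (bounded_obs_wave a2 (ph - th)).
have := EX_comb 1 bH bH; rewrite HH !(EX_comb 1 b1 b2) !aG => -[e e'].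
by move: e; rewrite e'; lra.
Qed.

(** The only place where [same_law] enters: the mean of a wave is an integral against the law of one
    linear combination. *)
Lemma agree1 : agree (fun=> 1).
Proof.
split; first exact: (multiplier1.1).
move=> a th; pose f (y : R) := (cos (y + th))%:E.
have mf : measurable_fun setT f.
  apply/measurable_EFinP.
  apply: (measurableT_comp (@continuous_measurable_fun _ _ (@continuous_cos R))).
  exact: measurable_funD.
have [iw iw'] := bounded_obs_integrable (bounded_obs_wave a th).
have mS' : measurable_fun setT (lincomb a X' : T' -> measurableTypeR R).
  exact: measurable_lincomb.
have mS : measurable_fun setT (lincomb a X : T -> measurableTypeR R).
  exact: measurable_lincomb.
rewrite /EX /EX' /Rintegral; congr fine.
under eq_integral do rewrite mul1r.
under [RHS]eq_integral do rewrite mul1r.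
rewrite -[LHS](@integral_pushforward _ _ _ _ _ _ mS P setT f)//.
rewrite -[RHS](@integral_pushforward _ _ _ _ _ _ mS' P' setT f)//.
by apply: eq_measure_integral => A mA _; exact: same_law.
Qed.

Lemma multiplier_expR F : multiplier F -> multiplier (fun x => expR (F x)).
Proof.
move=> mF; have [[[B FB] _ _] _] := mF.
(* Since [F] is bounded by B, its Taylor sums are bounded by e^B uniformly in n, as dominated
   convergence demands. *)
apply: (@multiplier_lim (fun n x => \sum_(k < n) k`!%:R^-1 * F x ^+ k) _ (expR B)).
- elim=> [|n IH].
    by under eq_fun do rewrite big_ord0; exact: multiplier_cst.
  under eq_fun do rewrite big_ord_recr/=.
  apply: multiplier_comb => //; elim: n {IH} => [|n IH].
    by under eq_fun do rewrite expr0; exact: multiplier1.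
  by under eq_fun do rewrite exprS; exact: multiplierM.
- by move=> n x; exact: expR_partial_le.
- by move=> x; exact: cvg_expR_partial.
Qed.

(* an entire function bounded on the real line is a bounded limit of
   polynomials in [k sin (x / k)]; the functions [exp (- exp (n^2 (x - t) - n))]
   are of this kind and converge boundedly to the indicator of [x <= t] *)
Lemma multiplier_le i t : multiplier (fun x => (x i <= t)%R%:R).
Proof.
have msin k : multiplier (fun x => k.+1%:R * sin (k.+1%:R^-1 * x i)).
  apply: multiplierZ.
  have := multiplier_wave (fun j => k.+1%:R^-1 * (j == i)%:R) (- (pi / 2)).
  congr multiplier; apply/funext => x; rewrite /wave (bigD1 i)//= eqxx big1.
    by rewrite mulr1 addr0 cosBpihalf.
  by move=> j /negbTE ->; rewrite mulr0 mul0r.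
apply: (@multiplier_lim (fun n x => expR (- expR (n%:R ^+ 2 * (x i - t) - n%:R))) _ 1).
- move=> n.
  apply: (@multiplier_lim (fun k x => expR (- expR
      (n%:R ^+ 2 * (k.+1%:R * sin (k.+1%:R^-1 * x i) - t) - n%:R))) _ 1).
  + move=> k; apply/multiplier_expR/multiplierN/multiplier_expR.
    have := multiplier_comb (n%:R ^+ 2) (multiplier_cst (- (n%:R ^+ 2 * t) - n%:R)) (msin k).
    by congr multiplier; apply/funext => x; ring.
  + by move=> k x; rewrite ger0_norm ?expR_ge0// -[leRHS]expR0 ler_expR oppr_le0 expR_ge0.
  + move=> x; apply: continuous_cvg; first exact: continuous_expR.
    apply: cvgN; apply: continuous_cvg; first exact: continuous_expR.
    apply: cvgB; last exact: cvg_cst.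
    apply: cvgMr; apply: cvgB; last exact: cvg_cst.
    exact: cvg_nsin.
- by move=> n x; rewrite ger0_norm ?expR_ge0// -[leRHS]expR0 ler_expR oppr_le0 expR_ge0.
- by move=> x; exact: cvg_double_exp.
Qed.

(** The product of the indicators of x_i <= t is a multiplier; applied to the constant 1 and tested
    on the wave of zero frequency and phase, it yields both probabilities. These boxes are the
    events that a maximum is at most t. *)
Lemma same_law_box t :
  P [set w | forall i, X i w <= t] = P' [set w | forall i, X' i w <= t].
Proof.
pose F (x : I -> R) : R := \prod_i (x i <= t)%R%:R.
have mF : multiplier F.
  rewrite /F; elim: (index_enum I) => [|i r IH].
    by under eq_fun do rewrite big_nil; exact: multiplier1.
  by under eq_fun do rewrite big_cons; apply: multiplierM => //; exact: multiplier_le.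
have [[_ mP mP'] _] := mF.
have [_ /(_ (fun=> 0) 0)] := mF.2 _ agree1.
have FE (x : I -> R) : F x * 1 * wave (fun=> 0) 0 x = (`[< forall i, x i <= t >])%:R.
  rewrite /wave big1 => [|i _]; last by rewrite mul0r.
  rewrite addr0 cos0 !mulr1 /F; case: asboolP => [h|/existsNP[i /negP h]].
    by rewrite big1// => i _; rewrite h.
  by rewrite (bigD1 i)//= (negbTE h) mul0r.
under [X in EX X]eq_fun do rewrite FE.
under [X in EX' X]eq_fun do rewrite FE.
have prob d0 (S : measurableType d0) (Q : probability S R) (Z : I -> S -> R) :
    (forall i, measurable_fun setT (Z i)) ->
    (\int[Q]_w (`[< forall i, Z i w <= t >])%:R : R)%:E = Q [set w | forall i, Z i w <= t].
  move=> mZ; set A := mkset _.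
  have mA : measurable A.
    rewrite (_ : A = \bigcap_(i in [set: I]) (Z i @^-1` `]-oo, t])).
      apply: fin_bigcap_measurable => // i _.
      by rewrite -[X in measurable X]setTI; exact: mZ.
    apply/seteqP; split => w /=; first by move=> h i _; rewrite /= in_itv/=.
    by move=> h i; have := h i Logic.I; rewrite /= in_itv.
  rewrite /Rintegral (eq_integral (fun w => (\1_A w)%:E)) => [|w _]; last first.
    by rewrite indicE.
  by rewrite integral_indic// setIT fineK// fin_num_measure.
by move=> EE; rewrite -!prob//; congr EFin; exact: EE.
Qed.

End uniqueness.

(** * Maximum of a Gaussian vector *)

Section maximum.
Context {R : realType} {I : finType}.

(** Seeding the fold with a member of the family leaves the maximum unchanged; with both coordinates
    of [i0] zero this is [fieldmax]. *)
Definition vmax T (i0 : I) (X : I -> T -> R) (w : T) : R :=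
  \big[Num.max/X i0 w]_i X i w.

Lemma vmax_le T (i0 : I) (X : I -> T -> R) w t :
  vmax i0 X w <= t <-> forall i, X i w <= t.
Proof.
split=> [h i|h]; first by apply: le_trans h; exact: le_bigmax_cond.
by apply: bigmax_le.
Qed.

Lemma le_vmax T (i0 : I) (X : I -> T -> R) w i : X i w <= vmax i0 X w.
Proof. exact: (vmax_le i0 X w _).1. Qed.

Lemma measurable_vmax d (T : measurableType d) (i0 : I) (X : I -> T -> R) :
  (forall i, measurable_fun setT (X i)) -> measurable_fun setT (vmax i0 X).
Proof.
move=> mX; rewrite /vmax; elim: (index_enum I) => [|i r IH].
  by under eq_fun do rewrite big_nil; exact: mX.
under eq_fun do rewrite big_cons; exact: measurable_maxr.
Qed.

Lemma vmax_norm_le T (i0 : I) (X : I -> T -> R) w : `|vmax i0 X w| <= \sum_i `|X i w|.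
Proof.
have h i : `|X i w| <= \sum_i `|X i w|.
  by rewrite (bigD1 i)//= lerDl sumr_ge0.
rewrite ler_norml; apply/andP; split.
  apply: le_trans (le_vmax i0 X w i0); rewrite lerNl.
  by apply: le_trans (h i0); rewrite -normrN ler_norm.
by apply/vmax_le => i; apply: le_trans (h i); exact: ler_norm.
Qed.

End maximum.

Lemma same_cdf_law (R : realType) d (T : measurableType d) (P : probability T R)
    d' (T' : measurableType d') (P' : probability T' R) (Z : T -> R) (Z' : T' -> R) :
  measurable_fun setT Z -> measurable_fun setT Z' ->
  (forall t, P [set w | Z w <= t] = P' [set w | Z' w <= t]) ->
  forall A : set R, measurable A -> P (Z @^-1` A) = P' (Z' @^-1` A).
Proof.
move=> mZ mZ' rays.
have ray (t : R) : P (Z @^-1` `]t, +oo[) = P' (Z' @^-1` `]t, +oo[).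
  have rayE d0 (S : measurableType d0) (Q : probability S R) (Y : S -> R) :
      measurable_fun setT Y -> Q (Y @^-1` `]t, +oo[) = (1 - Q [set w | Y w <= t]%R)%E.
    move=> mY; rewrite -probability_setC; last first.
      rewrite (_ : mkset _ = Y @^-1` `]-oo, t]).
        by rewrite -[X in measurable X]setTI; exact: mY.
      by apply/seteqP; split => w /=; rewrite in_itv.
    congr (Q _); apply/seteqP; split => w /=; rewrite in_itv/= andbT.
      by rewrite ltNge => /negP.
    by move=> /negP; rewrite -ltNge.
  by rewrite !rayE// rays.
pose fZ : {mfun T >-> R} := mfun_Sub (mem_set mZ).
pose fZ' : {mfun T' >-> R} := mfun_Sub (mem_set mZ').
move=> A mA; rewrite -[LHS]/(distribution P fZ A) -[RHS]/(distribution P' fZ' A).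
apply: (@measure_unique _ R R (@RGenOInfty.G R)
  (fun n => `](- n%:R : R), +oo[%classic)) => //.
- exact: RGenOInfty.measurableE.
- move=> _ _ [x ->] [y ->]; exists (Num.max x y); rewrite predeqE => z; split.
    by rewrite /= !in_itv/= !andbT gt_max => -[-> ->].
  by rewrite /= !in_itv/= !andbT gt_max => /andP[xz yz]; split.
- by move=> n; exists (- n%:R).
- apply/seteqP; split=> // x _; near \oo => n; exists n => //=.
  rewrite in_itv/= andbT ltrNl; apply: le_lt_trans (ler_norm _) _.
  by rewrite normrN; near: n; exact: nbhs_infty_gtr.
- by move=> _ [t ->]; exact: ray.
- by move=> n; rewrite (le_lt_trans (probability_le1 _ _)) ?ltry.
Unshelve. all: by end_near.
Qed.

Section gaussian_maximum.
Context {R : realType} {I : finType}.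
Implicit Types C : I -> I -> R.

Lemma lincomb_expR d (T : measurableType d) (P : probability T R) C X (a : I -> R) :
  gaussian_vector P C X ->
  (\int[P]_w (expR (lincomb a X w))%:E = (expR (quad C a / 2))%:E)%E.
Proof.
move=> [mX C0 lX].
rewrite (@ge0_has_law_integral _ _ _ P (lincomb a X) (gauss (quad C a))
  (fun x => (expR x)%:E)) ?gauss_expR//.
  exact: measurable_lincomb.
by apply/measurable_EFinP; exact: measurable_expR.
Qed.

Lemma integrable_expR_lincomb d (T : measurableType d) (P : probability T R) C X (a : I -> R) :
  gaussian_vector P C X -> P.-integrable setT (fun w => (expR (lincomb a X w))%:E).
Proof.
move=> gX; have [mX _ _] := gX; apply/integrableP; split.
  apply/measurable_EFinP; apply: (measurableT_comp (@measurable_expR R)).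
  exact: measurable_lincomb.
under eq_integral do rewrite gee0_abs ?lee_fin ?expR_ge0//.
by rewrite (lincomb_expR a gX) ltry.
Qed.

(** Domination by exponential moments: |z| <= e^z + e^(-z). *)
Lemma integrable_lincomb d (T : measurableType d) (P : probability T R) C X (a : I -> R) :
  gaussian_vector P C X -> P.-integrable setT (EFin \o lincomb a X).
Proof.
move=> gX; have [mX _ _] := gX.
have ip := integrable_expR_lincomb a gX.
have iN := integrable_expR_lincomb (fun i => - a i) gX.
apply: (le_integrable measurableT _ _ (integrableD measurableT ip iN)).
  by apply/measurable_EFinP; exact: measurable_lincomb.
move=> w _ /=; rewrite lee_fin [leRHS]ger0_norm ?addr_ge0 ?expR_ge0//.
have -> : lincomb (fun i => - a i) X w = - lincomb a X w.
  by rewrite /lincomb -sumrN; apply: eq_bigr => i _; rewrite mulNr.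
move: (lincomb a X w) => z.
have := expR_ge1Dx z; have := expR_ge1Dx (- z).
have := expR_ge0 z; have := expR_ge0 (- z).
rewrite ler_norml; move: (expR z) (expR (- z)) => p q *; apply/andP; split; lra.
Qed.

Lemma lincomb_delta T (X : I -> T -> R) i :
  lincomb (fun j => (j == i)%:R) X = X i.
Proof.
apply/funext => w; rewrite /lincomb (bigD1 i)//= eqxx mul1r big1 ?addr0// => j /negbTE ->.
by rewrite mul0r.
Qed.

Lemma quad_delta C i : quad C (fun j => (j == i)%:R) = C i i.
Proof.
rewrite /quad (bigD1 i)//= (bigD1 i)//= !eqxx !mul1r !big1 ?addr0// => j /negbTE ji.
  by rewrite big1// => k _; rewrite ji !mul0r.
by rewrite ji mulr0 mul0r.
Qed.

Lemma integrable_vmax d (T : measurableType d) (P : probability T R) C X (i0 : I) :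
  gaussian_vector P C X -> P.-integrable setT (EFin \o vmax i0 X).
Proof.
move=> gX; have [mX _ _] := gX.
have iX i : P.-integrable setT (EFin \o X i).
  by rewrite -(lincomb_delta X i); exact: integrable_lincomb gX.
have iS : P.-integrable setT (fun w => \sum_(i <- index_enum I) (`|X i w|%:E))%E.
  by apply: integrable_sum => // i _; exact: integrable_norm (iX i).
apply: (le_integrable measurableT _ _ iS).
  by apply/measurable_EFinP; exact: measurable_vmax.
move=> w _ /=; rewrite sumEFin lee_fin; apply: le_trans (vmax_norm_le i0 X w) _.
exact: ler_norm.
Qed.

(** This allows a field to be replaced by any other realisation of its covariance. Both laws of the
    maximum are determined by the boxes of [same_law_box]. *)
Lemma vmax_expectation_unique d (T : measurableType d) (P : probability T R)
    d' (T' : measurableType d') (P' : probability T' R) C X X' (i0 : I) :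
  gaussian_vector P C X -> gaussian_vector P' C X' ->
  \int[P]_w vmax i0 X w = \int[P']_w vmax i0 X' w.
Proof.
move=> gX gX'; have [[mX _ lX] [mX' _ lX']] := (gX, gX').
have mV := measurable_vmax i0 mX; have mV' := measurable_vmax i0 mX'.
have mVr : measurable_fun setT (vmax i0 X : T -> measurableTypeR R) by [].
have mVr' : measurable_fun setT (vmax i0 X' : T' -> measurableTypeR R) by [].
rewrite /Rintegral; congr fine.
have mid : measurable_fun [set: measurableTypeR R] (EFin : measurableTypeR R -> \bar R).
  by apply/measurable_EFinP.
rewrite -[LHS](@integral_pushforward _ _ _ _ _ _ mVr P setT EFin)//; last first.
  exact: integrable_vmax gX.
rewrite -[RHS](@integral_pushforward _ _ _ _ _ _ mVr' P' setT EFin)//; last first.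
  exact: integrable_vmax gX'.
apply: eq_measure_integral => A mA _.
apply: same_cdf_law => // t.
have lE S (Z : I -> S -> R) : [set w | vmax i0 Z w <= t] = [set w | forall i, Z i w <= t].
  by apply/seteqP; split => w /=; rewrite vmax_le.
rewrite !lE; apply: same_law_box => // a B mB.
by rewrite lX// lX'.
Qed.

(** Pointwise, X_i <= s + e^(X_i - s) <= s + e^(-s) times the sum of all e^(X_j); the level [s] is
    left free to balance the number of sites. *)
Lemma vmax_expectation_le d (T : measurableType d) (P : probability T R) C X (i0 : I) (s : R) :
  gaussian_vector P C X ->
  \int[P]_w vmax i0 X w <= s + expR (- s) * \sum_i expR (C i i / 2).
Proof.
move=> gX.
have ei i := integrable_expR_lincomb (fun j => (j == i)%:R) gX.
have iS : P.-integrable setT (EFin \o (fun w => \sum_i expR (X i w))).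
  rewrite (_ : EFin \o _ = fun w => (\sum_(i <- index_enum I) (expR (X i w))%:E)%E).
    by apply: integrable_sum => // i _; rewrite -(lincomb_delta X i).
  by apply/funext => w /=; rewrite sumEFin.
have iZ := @integrableZl _ _ _ P _ measurableT (expR (- s)) _ iS.
have icst : P.-integrable setT (EFin \o (fun _ : T => s)).
  exact: finite_measure_integrable_cst.
apply: (@le_trans _ _ (\int[P]_w (s + expR (- s) * \sum_i expR (X i w)))).
  apply: le_Rintegral => //.
  - exact: integrable_vmax gX.
  - exact: (integrableD measurableT icst iZ).
  move=> w _; apply/vmax_le => i.
  rewrite (bigD1 i)//= mulrDr -expRD addrA.
  apply: (@le_trans _ _ (s + expR (- s + X i w))).
    by rewrite -lerBlDl addrC; apply: le_trans (expR_ge1Dx _); rewrite lerDr.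
  by rewrite lerDl mulr_ge0 ?expR_ge0// sumr_ge0// => j _; exact: expR_ge0.
rewrite RintegralD// RintegralZl// Rintegral_cst// [X in fine X](_ : _ = 1%E); last first.
  exact: probability_setT.
rewrite mulr1 lerD2l.
rewrite ler_wpM2l ?expR_ge0// /Rintegral.
under eq_integral do rewrite -sumEFin.
rewrite integral_sum// => [|i]; last by rewrite -(lincomb_delta X i).
rewrite le_eqVlt; apply/orP; left; apply/eqP.
rewrite (eq_bigr (fun i => (expR (C i i / 2))%:E)) => [|i _].
  by rewrite sumEFin.
by rewrite -(lincomb_delta X i) (lincomb_expR _ gX) quad_delta.
Qed.

End gaussian_maximum.

(** * Monotonicity of the mean maximum *)

Section comparison.
Context {R : realType}.

Lemma gaussian_vector_reindex d (T : measurableType d) (P : probability T R)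
    (I J : finType) (C : I -> I -> R) (X : I -> T -> R) (f : J -> I) :
  gaussian_vector P C X ->
  gaussian_vector P (fun j k => C (f j) (f k)) (fun j => X (f j)).
Proof.
move=> gX; have := gaussian_vector_linear (fun j i => (i == f j)%:R) gX.
congr gaussian_vector; last by apply/funext => j; rewrite lincomb_delta.
apply/funext => j; apply/funext => k; rewrite /congruence.
rewrite (bigD1 (f j))//= (bigD1 (f k))//= !eqxx !mul1r.
rewrite !big1 ?addr0// => [i /negbTE ifj|i /negbTE ifk].
  by rewrite big1// => l _; rewrite ifj !mul0r.
by rewrite ifk mulr0 mul0r.
Qed.

Lemma has_law_cst0 d (T : measurableType d) (P : probability T R) :
  has_law P (cst 0) (gauss 0).
Proof.
move=> A mA; rewrite preimage_cst /gauss eqxx [RHS]/= diracE.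
by case: ifPn => A0; [rewrite [LHS]probability_setT|rewrite measure0].
Qed.

Lemma gaussian_vector_const0 (I : finType) :
  gaussian_vector (gauss 0 : probability (measurableTypeR R) R)
    (fun _ _ : I => 0) (fun _ _ => 0).
Proof.
have q0 (a : I -> R) : quad (fun _ _ => 0) a = 0.
  by apply: big1 => i _; apply: big1 => j _; rewrite mulr0.
split=> [i|a|a]; first exact: measurable_cst.
  by rewrite q0.
rewrite q0 (_ : lincomb a _ = cst 0); first exact: has_law_cst0.
by apply/funext => w; apply: big1 => i _; rewrite mulr0.
Qed.

Lemma scaled_lebesgue_measure (a : R) : a != 0 ->
  exists nu : {measure set (measurableTypeR R) -> \bar R},
    (forall A, nu A = (`|a|%:E * lebesgue_measure [set x | A (a * x)%R])%E) /\
    (forall f : R -> \bar R, measurable_fun setT f -> (forall x, 0 <= f x)%E ->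
      (\int[nu]_x f x = `|a|%:E * \int[lebesgue_measure]_x f (a * x)%R)%E).
Proof.
move=> a0.
have mf : measurable_fun [set: measurableTypeR R]
    (fun x : measurableTypeR R => a * x : measurableTypeR R).
  exact: measurable_funM.
unshelve refine (ex_intro _ (mscale (`|a|%:nng) (pushforward (@lebesgue_measure R)
  (fun x : measurableTypeR R => a * x : measurableTypeR R)) :
  {measure set (measurableTypeR R) -> \bar R}) _); first exact: mf.
split=> // f mfe f0; rewrite ge0_integral_mscale//; congr (_ * _)%E.
exact: (ge0_integral_pushforward mf).
Qed.

Lemma lebesgue_measure_scale (a : R) (A : set R) : a != 0 -> measurable A ->
  (`|a|%:E * lebesgue_measure [set x | A (a * x)%R])%E = lebesgue_measure A.
Proof.
move=> a0 mA; have [nu [nuE _]] := scaled_lebesgue_measure a0.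
rewrite -nuE; apply/esym; apply: lebesgue_measure_unique => // X [[l r]/= _ <-].
rewrite nuE.
have [a_gt0|a_le0] := ltP 0 a.
  have -> : [set x : R | `]l, r]%classic (a * x)] = `]l / a, r / a]%classic.
    apply/seteqP; split => x; rewrite /= !in_itv/=;
    by rewrite ltr_pdivrMr// ler_pdivlMr// ![a * x]mulrC.
  rewrite !lebesgue_measure_itv/= !lte_fin ltr_pM2r ?invr_gt0//.
  rewrite gtr0_norm//; case: ifP => _; last by rewrite mule0.
  by rewrite -!EFinB -EFinM; congr EFin; field.
have a_lt0 : a < 0 by rewrite lt_neqAle a0.
have -> : [set x : R | `]l, r]%classic (a * x)] = `[r / a, l / a[%classic.
  apply/seteqP; split => x; rewrite /= !in_itv/=;
  by rewrite ltr_ndivlMr// ler_ndivrMr// ![a * x]mulrC andbC.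
rewrite !lebesgue_measure_itv/= !lte_fin ltr_nM2r ?invr_lt0//.
rewrite ltr0_norm//; case: ifP => _; last by rewrite mule0.
by rewrite -!EFinB -EFinM; congr EFin; field.
Qed.

Lemma normal_prob_scale (a : R) (A : set R) : a != 0 -> measurable A ->
  normal_prob 0 1 [set x | A (a * x)] = normal_prob 0 `|a| A.
Proof.
move=> a0 mA; have [nu [nuE nu_int]] := scaled_lebesgue_measure a0.
have na : `|a| != 0 by rewrite normr_eq0.
pose g (x : R) := normal_pdf 0 `|a| x * \1_A x.
have g0 x : 0 <= g x by rewrite mulr_ge0 ?normal_pdf_ge0.
have mg : measurable_fun setT (fun x : measurableTypeR R => (g x)%:E).
  apply/measurable_EFinP; apply: measurable_funM; first exact: measurable_normal_pdf.
  exact: measurable_indic.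
transitivity (\int[lebesgue_measure]_x (g x)%:E)%E; last first.
  rewrite /normal_prob [RHS]integral_mkcond epatch_indic.
  by apply: eq_integral => x _; rewrite -EFinM.
transitivity (\int[nu]_x (g x)%:E)%E; last first.
  by apply: eq_measure_integral => B mB _; rewrite nuE lebesgue_measure_scale.
rewrite nu_int//.
have mga : measurable_fun [set: measurableTypeR R]
    (fun x : measurableTypeR R => (g (a * x))%:E).
  by apply: (measurableT_comp mg); exact: measurable_funM.
rewrite -ge0_integralZl//; last by move=> x _; rewrite lee_fin.
rewrite /normal_prob [LHS]integral_mkcond epatch_indic.
apply: eq_integral => x _; rewrite -!EFinM; congr EFin; rewrite /g mulrA.
congr (_ * _); rewrite !normal_pdfE ?oner_eq0// mulrA; congr (_ * _).
  rewrite /normal_peak.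
  have -> : `|a| ^+ 2 * pi *+ 2 = `|a| ^+ 2 * (1 ^+ 2 * pi *+ 2) by ring.
  by rewrite sqrtrM ?sqr_ge0// sqrtr_sqr normr_id invfM mulVKf.
rewrite /normal_fun !subr0 real_normK ?num_real// exprMn; congr expR.
by field.
Qed.

Lemma gaussian_vector_id :
  gaussian_vector (gauss 1 : probability (measurableTypeR R) R)
    (fun _ _ : 'I_1 => 1) (fun _ x => x).
Proof.
have qE (a : 'I_1 -> R) : quad (fun _ _ => 1) a = a ord0 ^+ 2.
  by rewrite /quad !big_ord1 mulr1.
split=> [i|a|a].
- exact: measurable_id.
- by rewrite qE sqr_ge0.
- rewrite qE (_ : lincomb a _ = fun x : R => a ord0 * x); last first.
    by apply/funext => x; rewrite /lincomb big_ord1.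
  have [a0|a0] := eqVneq (a ord0) 0.
    rewrite a0 expr0n/= (_ : (fun x => _) = cst 0); first exact: has_law_cst0.
    by apply/funext => x; rewrite mul0r.
  move=> A mA; rewrite {2}/gauss sqrf_eq0 (negbTE a0) sqrtr_sqr/=.
  by rewrite /gauss oner_eq0 sqrtr1 -normal_prob_scale.
Qed.

(* by convexity [vmax X] is at most the mean of [vmax (X + v xi)] and
   [vmax (X - v xi)], which have the same law *)
Lemma add_rank_one d (T : measurableType d) (P : probability T R)
    (I : finType) (C : I -> I -> R) (X : I -> T -> R) (v : I -> R) (i0 : I) :
  gaussian_vector P C X ->
  exists d' (T' : measurableType d') (P' : probability T' R) (X' : I -> T' -> R),
    gaussian_vector P' (fun i j => C i j + v i * v j) X' /\
    \int[P]_w vmax i0 X w <= \int[P']_w vmax i0 X' w.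
Proof.
move=> gX; have gZ := gaussian_vector_pair gX gaussian_vector_id.
pose Z (s : I + 'I_1) (w : T * measurableTypeR R) : R :=
  match s with inl i => X i w.1 | inr _ => w.2 end.
have {}gZ : gaussian_vector (P \x gauss 1)%E (block C (fun _ _ => 1)) Z by exact: gZ.
pose B e i (s : I + 'I_1) : R := match s with inl j => (j == i)%:R | inr _ => e * v i end.
have BZ e i : lincomb (B e i) Z = fun w => X i w.1 + e * v i * w.2.
  apply/funext => w; rewrite /lincomb big_sumType/= big_ord1; congr (_ + _).
  exact: (congr1 (fun f => f w.1) (lincomb_delta X i)).
have gB e : gaussian_vector (P \x gauss 1)%E (fun i j => C i j + e ^+ 2 * v i * v j)
    (fun i w => X i w.1 + e * v i * w.2).
  have := gaussian_vector_linear (B e) gZ.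
  congr gaussian_vector; last by apply/funext => i; exact: BZ.
  apply/funext => i; apply/funext => j; rewrite /congruence big_sumType/= big_ord1.
  rewrite big_sumType/= big_ord1/=; congr (_ + _); last first.
    by rewrite big1 => [|k _]; [ring|rewrite mulr0].
  rewrite (bigD1 i)//= big_sumType/= big_ord1 (bigD1 j)//= !eqxx !mul1r mulr0 addr0.
  rewrite !big1 ?addr0// => [k /negbTE ki|k /negbTE kj]; last by rewrite kj mulr0 mul0r.
  rewrite big_sumType/= big1 => [|l _]; last by rewrite ki !mul0r.
  by rewrite big1 => [|l _]; rewrite ?addr0// mulr0.
pose Y e i (w : T * measurableTypeR R) := X i w.1 + e * v i * w.2.
have gY e : e ^+ 2 = 1 ->
    gaussian_vector (P \x gauss 1)%E (fun i j => C i j + v i * v j) (Y e).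
  move=> e1; have := gB e; congr gaussian_vector.
  by apply/funext => i; apply/funext => j; rewrite e1 mul1r.
have g1 := gY 1 (expr1n _ _).
have gN1 : gaussian_vector (P \x gauss 1)%E (fun i j => C i j + v i * v j) (Y (-1)).
  by apply: gY; rewrite sqrrN expr1n.
(* The value e = 0 gives a copy of [X] on the product space, where the three maxima can be compared
   pointwise. *)
have g0 : gaussian_vector (P \x gauss 1)%E C (Y 0).
  have := gB 0; congr gaussian_vector.
  by apply/funext => i; apply/funext => j; rewrite expr0n !mul0r addr0.
exists _, _, (P \x gauss 1)%E, (Y 1); split; first exact: g1.
have := vmax_expectation_unique i0 gX g0; have := vmax_expectation_unique i0 g1 gN1.
have [i1 iN1] := (integrable_vmax i0 g1, integrable_vmax i0 gN1).
have i00 := integrable_vmax i0 g0.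
have : \int[(P \x gauss 1)%E]_w (vmax i0 (Y 0) w + vmax i0 (Y 0) w) <=
    \int[(P \x gauss 1)%E]_w (vmax i0 (Y 1) w + vmax i0 (Y (-1)) w).
  apply: le_Rintegral => //.
  - exact: (integrableD measurableT i00 i00).
  - exact: (integrableD measurableT i1 iN1).
  move=> w _; rewrite -mulr2n -[leLHS]mulr_natr -ler_pdivlMr//.
  apply/vmax_le => i; rewrite ler_pdivlMr//.
  have := le_vmax i0 (Y 1) w i; have := le_vmax i0 (Y (-1)) w i.
  by rewrite /Y; lra.
by rewrite !RintegralD//; lra.
Qed.

Lemma add_psd d (T : measurableType d) (P : probability T R)
    (I : finType) (C : I -> I -> R) (X : I -> T -> R) (vs : seq (I -> R)) (i0 : I) :
  gaussian_vector P C X ->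
  exists d' (T' : measurableType d') (P' : probability T' R) (X' : I -> T' -> R),
    gaussian_vector P' (fun i j => C i j + \sum_(v <- vs) v i * v j) X' /\
    \int[P]_w vmax i0 X w <= \int[P']_w vmax i0 X' w.
Proof.
elim: vs d T P C X => [|v vs IH] d T P C X gX.
  exists d, T, P, X; split; last exact: lexx.
  have := gX; congr gaussian_vector.
  by apply/funext => i; apply/funext => j; rewrite big_nil addr0.
have [d1 [T1 [P1 [X1 [g1 le1]]]]] := add_rank_one v i0 gX.
have [d2 [T2 [P2 [X2 [g2 le2]]]]] := IH _ _ _ _ _ g1.
exists d2, T2, P2, X2; split; last exact: le_trans le2.
have := g2; congr gaussian_vector.
by apply/funext => i; apply/funext => j; rewrite big_cons addrA.
Qed.

(** Gram terms are added to the zero vector. The theorem provides a field on V_N only, while the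
    comparison also needs one on V_2N. *)
Lemma gaussian_vector_exists (I : finType) (C : I -> I -> R) (i0 : I) :
  (forall i j, C i j = C j i) -> (forall a, 0 <= quad C a) ->
  exists d (T : measurableType d) (P : probability T R) (X : I -> T -> R),
    gaussian_vector P C X.
Proof.
move=> Csym Cpsd; have [vs vsE] := psd_gram Csym Cpsd.
have [d [T [P [X [gX _]]]]] := add_psd vs i0 (gaussian_vector_const0 I).
exists d, T, P, X; have := gX; congr gaussian_vector.
by apply/funext => i; apply/funext => j; rewrite add0r -vsE.
Qed.

(** Adding to [X] the Gram terms of C' - C produces a vector of covariance C'. The order is that of
    quadratic forms, not the comparison of increments of Slepian type. *)
Lemma vmax_expectation_mono (I : finType) (i0 : I)
    d (T : measurableType d) (P : probability T R)
    d' (T' : measurableType d') (P' : probability T' R) (C C' : I -> I -> R) X X' :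
  gaussian_vector P C X -> gaussian_vector P' C' X' ->
  (forall i j, C i j = C j i) -> (forall i j, C' i j = C' j i) ->
  (forall a, quad C a <= quad C' a) ->
  \int[P]_w vmax i0 X w <= \int[P']_w vmax i0 X' w.
Proof.
move=> gX gX' Csym C'sym CC'.
have [i j||vs vsE] := @psd_gram _ _ (fun i j => C' i j - C i j).
- by rewrite Csym C'sym.
- move=> a; have := CC' a; rewrite -subr_ge0 /quad -sumrB; congr (0 <= _).
  apply: eq_bigr => i _; rewrite -sumrB; apply: eq_bigr => j _.
  by rewrite mulrBr.
have [d2 [T2 [P2 [X2 [g2 le2]]]]] := add_psd vs i0 gX.
apply: (le_trans le2); rewrite le_eqVlt; apply/orP; left; apply/eqP.
apply: vmax_expectation_unique gX'; have := g2; congr gaussian_vector.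
by apply/funext => i; apply/funext => j; rewrite -vsE addrC subrK.
Qed.

End comparison.

(** * Tightness *)

Section tightness.
Context {R : realType}.

Definition gff_cov N (u v : VN N) : R := green N (pt u) (pt v).

Lemma gff_cov_sym N (u v : VN N) : gff_cov u v = gff_cov v u.
Proof. exact: green_sym. Qed.

Lemma gff_cov_psd N (c : VN N -> R) : 0 <= quad (@gff_cov N) c.
Proof. exact: green_psd. Qed.

Lemma integrable_fst_snd d (T : measurableType d) (P : probability T R)
    (I : finType) (C : I -> I -> R) (X : I -> T -> R) (i0 : I) : gaussian_vector P C X ->
  [/\ (P \x P)%E.-integrable setT (fun w => (vmax i0 X w.1)%:E),
      (P \x P)%E.-integrable setT (fun w => (vmax i0 X w.2)%:E),
      \int[(P \x P)%E]_w vmax i0 X w.1 = \int[P]_w vmax i0 X w &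
      \int[(P \x P)%E]_w vmax i0 X w.2 = \int[P]_w vmax i0 X w].
Proof.
move=> gX; have gXX := gaussian_vector_pair gX gX.
have g1 := gaussian_vector_reindex (fun i => inl i) gXX.
have g2 := gaussian_vector_reindex (fun i => inr i) gXX.
split.
- exact: (integrable_vmax i0 g1).
- exact: (integrable_vmax i0 g2).
- exact: (vmax_expectation_unique i0 g1 gX).
- exact: (vmax_expectation_unique i0 g2 gX).
Qed.

(* two independent copies of the field on [V_N] sit, up to an independent
   Gaussian correction, in opposite corners of [V_2N] *)
Lemma independent_copies_le N d (T : measurableType d) (P : probability T R)
    d' (T' : measurableType d') (Q : probability T' R)
    (X : VN N -> T -> R) (Z : VN (N + N) -> T' -> R) i0 j0 :
  gaussian_vector P (@gff_cov N) X -> gaussian_vector Q (@gff_cov (N + N)) Z ->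
  (P \x P)%E.-integrable setT (fun w => `|vmax i0 X w.1 - vmax i0 X w.2|%:E) /\
  \int[(P \x P)%E]_w `|vmax i0 X w.1 - vmax i0 X w.2| <=
    2 * (\int[Q]_w vmax j0 Z w - \int[P]_w vmax i0 X w).
Proof.
move=> gX gZ; have gXX := gaussian_vector_pair gX gX.
set W := (fun s w => _) in gXX.
pose r := corners N (@pt N) (@pt N).
pose f s : VN (N + N) := (inord (r s).1, inord (r s).2).
have ptf s : pt (f s) = r s.
  have rN : ((r s).1 <= N + N)%N /\ ((r s).2 <= N + N)%N.
    rewrite /r /corners; case: s => -[u1 u2] /=; rewrite /pt/=;
    by have := ltn_ord u1; have := ltn_ord u2; lia.
  by rewrite /pt /f !inordK ?ltnS ?rN.1 ?rN.2//; case: (r s).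
have gY := gaussian_vector_reindex f gZ.
have [iX1 iX2 E1 E2] := integrable_fst_snd i0 gX.
have iW := integrable_vmax (inl i0) gXX.
have absE w : `|vmax i0 X w.1 - vmax i0 X w.2| =
    2 * vmax (inl i0) W w - (vmax i0 X w.1 + vmax i0 X w.2).
  have WE : vmax (inl i0) W w = Num.max (vmax i0 X w.1) (vmax i0 X w.2).
    apply/eqP; rewrite eq_le; apply/andP; split.
      apply/vmax_le => -[i|i]; rewrite le_max.
        by rewrite [X in X || _](le_vmax i0 X w.1 i).
      by rewrite [X in _ || X](le_vmax i0 X w.2 i) orbT.
    rewrite ge_max; apply/andP; split; apply/vmax_le => i.
      exact: (le_vmax (inl i0) W w (inl i)).
    exact: (le_vmax (inl i0) W w (inr i)).
  rewrite WE; move: (vmax i0 X w.1) (vmax i0 X w.2) => x y.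
  by have [xy|yx] := leP x y; [rewrite ler0_norm|rewrite gtr0_norm]; lra.
have i2W := @integrableZl _ _ _ _ _ measurableT 2 _ iW.
have i12 := integrableD measurableT iX1 iX2.
split.
  rewrite (_ : (fun w => _) = EFin \o
    (fun w => 2 * vmax (inl i0) W w - (vmax i0 X w.1 + vmax i0 X w.2))).
    exact: (integrableB measurableT i2W i12).
  by apply/funext => w /=; rewrite absE.
under [X in X <= _]eq_Rintegral do rewrite absE.
rewrite RintegralB// RintegralZl// RintegralD// E1 E2.
suff : \int[(P \x P)%E]_w vmax (inl i0) W w <= \int[Q]_w vmax j0 Z w by lra.
(* Restricting the large field to the two corners can only lower its maximum, and there
   [green_block_le] compares the covariances. *)
apply: (@le_trans _ _ (\int[Q]_w vmax (inl i0) (fun s => Z (f s)) w)).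
  apply: (vmax_expectation_mono _ gXX gY).
  - by case=> [u|u] [v|v] //=; exact: gff_cov_sym.
  - by move=> s t; exact: gff_cov_sym.
  - move=> c; rewrite /quad /gff_cov.
    under [leRHS]eq_bigr do under eq_bigr do rewrite !ptf.
    apply: green_block_le => u; have := ltn_ord u.1; by rewrite ltnS.
apply: le_Rintegral => //.
- exact: (integrable_vmax (inl i0) gY).
- exact: (integrable_vmax j0 gZ).
- by move=> w _; apply/vmax_le => s; exact: le_vmax.
Qed.

(** For a fixed first copy, V - E V is the mean of V - V' over the second copy; the absolute value
    then moves inside the integral. *)
Lemma mean_deviation_le d (T : measurableType d) (P : probability T R) (V : T -> R) :
  measurable_fun setT V -> P.-integrable setT (EFin \o V) ->
  (\int[P]_w `|V w - \int[P]_x V x|%:E <= \int[(P \x P)%E]_w `|V w.1 - V w.2|%:E)%E.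
Proof.
move=> mV iV.
have mVV : measurable_fun setT (fun w : T * T => `|V w.1 - V w.2|%:E).
  apply/measurable_EFinP; apply: measurableT_comp => //; apply: measurable_funB.
    exact: (measurableT_comp mV measurable_fst).
  exact: (measurableT_comp mV measurable_snd).
have VV0 (w : T * T) : (0 <= `|V w.1 - V w.2|%:E)%E by rewrite lee_fin.
rewrite (fubini_tonelli1 _ mVV VV0).
have P1 : fine (P setT) = 1 by rewrite (_ : P setT = 1%E)//; exact: probability_setT.
apply: ge0_le_integral => //.
- apply/measurable_EFinP; apply: measurableT_comp => //.
  exact: measurable_funB.
- exact: (measurable_fun_fubini_tonelli_F (m2 := P) _ mVV VV0).
move=> w _; rewrite /fubini_F/=.
have ic : P.-integrable setT (EFin \o (fun _ : T => V w)).
  exact: finite_measure_integrable_cst.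
have iw : P.-integrable setT (EFin \o (fun x => V w - V x)).
  exact: (integrableB measurableT ic iV).
have -> : V w - \int[P]_x V x = \int[P]_x (V w - V x).
  by rewrite RintegralB// Rintegral_cst// P1 mulr1.
rewrite EFin_normr_Rintegral//.
exact: (le_abse_integral _ _ (measurable_int _ iw)).
Qed.

(** The level s = 8(n+1) works because variances are at most 8(n+1), so each exponential moment is
    at most e^(4(n+1)), and the number (2^n + 1)^2 of sites is at most 4^(n+1) <= e^(4(n+1)). The
    correction to s is then at most 1, whence the constant 9. *)
Lemma gff_max_mean_le n d (T : measurableType d) (P : probability T R)
    (X : VN (2 ^ n) -> T -> R) i0 :
  gaussian_vector P (@gff_cov (2 ^ n)) X -> \int[P]_w vmax i0 X w <= 9 * n.+1%:R.
Proof.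
move=> gX; apply: le_trans (vmax_expectation_le i0 (8 * n.+1%:R) gX) _.
apply: (@le_trans _ _ (8 * n.+1%:R + expR (- (8 * n.+1%:R)) *
    \sum_(i : VN (2 ^ n)) expR (4 * n.+1%:R))).
  rewrite lerD2l ler_wpM2l ?expR_ge0//; apply: ler_sum => i _.
  rewrite ler_expR ler_pdivrMr//; apply: le_trans (green_diag_le _ _) _.
  have := @harmonic_pow2_le R n; lra.
rewrite sumr_const card_prod card_ord.
have h4 : 4 <= expR 4 :> R by apply: le_trans (expR_ge1Dx _); lra.
have card_le : ((2 ^ n).+1 * (2 ^ n).+1)%:R <= expR (4 * n.+1%:R) :> R.
  rewrite mulrC expRM_natl; apply: (@le_trans _ _ (4 ^+ n.+1)).
    rewrite -natrX ler_nat (_ : 4 = 2 * 2)%N// expnMn leq_mul//;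
    by rewrite expnS mul2n -addnn -addn1 leq_add2l expn_gt0.
  by rewrite lerXn2r ?nnegrE ?expR_ge0.
have : expR (- (8 * n.+1%:R)) * (expR (4 * n.+1%:R) *+ ((2 ^ n).+1 * (2 ^ n).+1)) <= 1 :> R.
  rewrite -(mulr_natr (expR (4 * _))).
  apply: (@le_trans _ _ (expR (- (8 * n.+1%:R)) * (expR (4 * n.+1%:R) * expR (4 * n.+1%:R)))).
    by apply: ler_wpM2l; rewrite ?expR_ge0//; apply: ler_wpM2l; rewrite ?expR_ge0.
  by rewrite -!expRD (_ : _ + _ = 0) ?expR0//; ring.
have : 1 <= n.+1%:R :> R by rewrite ler1n.
lra.
Qed.

(** Otherwise the sequence would grow with slope 2K from [k] on and overtake its linear bound of
    slope K. *)
Lemma small_increment (a : nat -> R) (K : R) : 0 < K ->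
  (forall n, a n <= K * n.+1%:R) -> forall k, exists n, (k <= n)%N /\ a n.+1 - a n <= 2 * K.
Proof.
move=> K0 aK k; apply: contrapT => /forallNP h.
have grow j : a k + 2 * K * j%:R <= a (k + j)%N.
  elim: j => [|j IH]; first by rewrite mulr0 addr0 addn0.
  have := h (k + j)%N; rewrite leq_addr addnS => /not_andP[//|/negP].
  by rewrite -ltNge -natr1; lra.
(* Growth and upper bound together give K j <= K (k+1) - a_k, which fails at any integer j above
   [x]. *)
pose x := `|(K * k.+1%:R - a k) / K|.
have jx : x < (Num.bound x)%:R by apply: archi_boundP; rewrite normr_ge0.
have := le_trans (grow (Num.bound x)) (aK _); rewrite -addnS natrD.
have : K * k.+1%:R - a k < K * (Num.bound x)%:R.
  by rewrite [ltRHS]mulrC -ltr_pdivrMr// (le_lt_trans _ jx)// ler_norm.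
by rewrite -[(Num.bound x).+1%:R]natr1 -[k.+1%:R]natr1; lra.
Qed.

(** A realisation exists and all realisations share the same mean, so [a] depends on neither the
    space nor the field. *)
Lemma gff_max_mean_exists : exists a : nat -> R, forall n d (T : measurableType d)
    (P : probability T R) (X : VN (2 ^ n) -> T -> R),
  gaussian_vector P (@gff_cov (2 ^ n)) X ->
  \int[P]_w vmax (ord0, ord0) X w = a n.
Proof.
have /choice[a aE] n : exists r, forall d (T : measurableType d)
    (P : probability T R) (X : VN (2 ^ n) -> T -> R),
    gaussian_vector P (@gff_cov (2 ^ n)) X ->
    \int[P]_w vmax (ord0, ord0) X w = r.
  have [d [T [P [X gX]]]] := gaussian_vector_exists (ord0, ord0)
    (@gff_cov_sym (2 ^ n)) (@gff_cov_psd (2 ^ n)).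
  exists (\int[P]_w vmax (ord0, ord0) X w) => d' T' P' X' gX'.
  exact: vmax_expectation_unique gX' gX.
by exists a.
Qed.

Lemma markov_norm d (T : measurableType d) (P : probability T R) (Y : T -> R) (B M : R) :
  0 < M -> measurable_fun setT Y -> (\int[P]_w `|Y w|%:E <= B%:E)%E ->
  (P [set w | (M < `|Y w|)%R] <= (B / M)%:E)%E.
Proof.
move=> M0 mY YB; set A := mkset _.
have mA : measurable A.
  rewrite (_ : A = (fun w => `|Y w|) @^-1` `]M, +oo[).
    rewrite -[X in measurable X]setTI.
    have mN : measurable_fun setT (fun w => `|Y w|) by exact: measurableT_comp.
    exact: mN.
  by apply/seteqP; split => w /=; rewrite in_itv/= andbT.
have h : (M%:E * P A <= B%:E)%E.
  apply: le_trans YB; rewrite -[A]setIT -integral_indic//.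
  rewrite -ge0_integralZl//; last 2 first.
  - exact/measurable_EFinP/measurable_indic.
  - by rewrite lee_fin ltW.
  apply: ge0_le_integral => //.
  - by move=> w _; rewrite -EFinM lee_fin mulr_ge0// ltW.
  - apply/measurable_EFinP; apply: measurable_funM => //; exact: measurable_indic.
  - by apply/measurable_EFinP; exact: measurableT_comp.
  move=> w _; rewrite -EFinM lee_fin indicE; case: (boolP (w \in A)) => [/set_mem|_].
    by rewrite mulr1 => /ltW.
  by rewrite mulr0.
have PA : P A \is a fin_num by rewrite fin_num_measure.
by move: h; rewrite -(fineK PA) -EFinM !lee_fin mulrC ler_pdivlMr.
Qed.

End tightness.

(* There is n_k -> oo such that, with N_k = 2^{n_k}, the family
   Y_{N_k} = X_{N_k}^* - E X_{N_k}^* is tight. *)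
Theorem theorem1 (R : realType) :
  exists n : nat -> nat,
    (forall B : nat, exists K : nat, forall k : nat, (K <= k)%N -> (B <= n k)%N) /\
    forall eps : R, 0 < eps ->
      exists M : R, forall (k : nat) (d : measure_display) (T : measurableType d)
        (P : probability T R) (X : VN (2 ^ n k) -> T -> R),
        is_DGFF P X ->
        (P [set w | (M < `| fieldmax X w - fine ('E_P[fieldmax X])%E |)%R ]
           <= eps%:E)%E.
Proof.
have [a aE] := @gff_max_mean_exists R.
have real n : exists d (T : measurableType d) (P : probability T R)
    (X : VN (2 ^ n) -> T -> R), gaussian_vector P (@gff_cov R (2 ^ n)) X.
  exact: gaussian_vector_exists (ord0, ord0)
    (@gff_cov_sym R (2 ^ n)) (@gff_cov_psd R (2 ^ n)).
have a_le n : a n <= 9 * n.+1%:R.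
  have [d [T [P [X gX]]]] := real n.
  by rewrite -(aE _ _ _ _ _ gX); exact: gff_max_mean_le gX.
have [n nP] := choice (small_increment (ltr0n R 9) a_le).
exists n; split=> [B|eps eps0].
  by exists B => k Bk; apply: leq_trans Bk (nP k).1.
(* The slope 9 gives increments at most 18 along [n], hence E|M - M'| <= 36 for every [k], and
   Markov's inequality at level 36/eps leaves eps. *)
exists (36 / eps) => k d T P X.
have M0 : 0 < 36 / eps by rewrite divr_gt0.
move=> /(centered_gaussian_vector (@gff_cov_psd R _)) gX.
have [mX _ _] := gX; have iX := integrable_vmax (ord0, ord0) gX.
have mV := measurable_vmax (ord0, ord0) mX.
have epsE : 36 / (36 / eps) = eps by field; rewrite gt_eqF.
rewrite -[X in (_ <= X%:E)%E]epsE unlock.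
apply: (markov_norm M0
  (Y := fun w => vmax (ord0, ord0) X w - \int[P]_x vmax (ord0, ord0) X x)).
  exact: measurable_funB.
apply: le_trans (mean_deviation_le mV iX) _.
have [d' [T' [Q [Z gZ]]]] := real (n k).+1.
have EX := aE _ _ _ _ _ gX; have EZ := aE _ _ _ _ _ gZ.
(* The field on the next dyadic square is transported to the index [N + N] expected by the corner
   comparison. *)
have e : (2 ^ (n k).+1 = 2 ^ n k + 2 ^ n k)%N by rewrite expnS mul2n addnn.
rewrite e in Z gZ EZ.
have [iD le36] := independent_copies_le (ord0, ord0) (ord0, ord0) gX gZ.
rewrite -(fineK (integrable_fin_num measurableT iD)) lee_fin; apply: le_trans le36 _.
by rewrite EX EZ; have := (nP k).2; lra.
Qed.
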